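(* Let $\alpha,\epsilon>0$ be real numbers. Then there is an $n_0=n_0(\alpha,\epsilon)$ with the following property. Suppose that $n>n_0(\alpha,\epsilon)$, and that $A\subseteq\mathbb{F}_5^n$ is a set with density $\alpha$, that is $|A|=\alpha N$ where $N:=5^n$. Then there is some $d\in\mathbb{F}_5^n$, $d\neq 0$, such that $A$ contains at least $(\alpha^4-\epsilon)N$ four-term arithmetic progressions with common difference $d$; that is, there are at least $(\alpha^4-\epsilon)N$ elements $x\in\mathbb{F}_5^n$ for which $x,\ x+d,\ x+2d,\ x+3d$ all lie in $A$.
   Context: $\mathbb{F}_5^n$ is the $n$-dimensional vector space over the field with $5$ elements, and $N=5^n$ is its cardinality. *)

(* Defs.v *)
From mathcomp Require Import all_boot all_order all_algebra.
From mathcomp Require Import reals.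

Set Implicit Arguments.
Unset Strict Implicit.
Unset Printing Implicit Defensive.

Import GRing.Theory.
Local Open Scope ring_scope.

Definition ap4_starts (n : nat) (A : {set 'rV['F_5]_n}) (d : 'rV['F_5]_n) :
    {set 'rV['F_5]_n} :=
  [set x | [&& x \in A, x + d \in A, x + d *+ 2 \in A & x + d *+ 3 \in A]].

(* Main.v *)
Require Import Defs.
From mathcomp Require Import all_boot all_order all_algebra.
From mathcomp Require Import reals.
From mathcomp Require Import all_field.
From mathcomp Require Import ring zify.

(** Write [f] for the indicator function of [A] and fix [K] with [4 / K <= eps].
    The number of progressions of difference [d] is averaged over [d] in a
    subspace [V] of bounded codimension; if this average is at least
    [(alpha ^ 4 - 3 / K) N], some nonzero [d] in [V] works, since [d = 0] has
    negligible weight.  The subspace comes from a structure theorem for [f].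

    Structure.  A quadratic factor partitions the space into the joint level sets
    of a linear map [L] and of boundedly many quadratic polynomials, and [V] is
    the kernel of [L].  Let [f1] be the conditional expectation of [f] on such a
    factor.  If every nontrivial combination of the polynomials has high rank,
    then for [x] in a coset of [V] and [d] in [V] the values at [x], [x + d],
    [x + 2d] are nearly independent and uniform ([ap3_equidistribution]), and the
    value at [x + 3d] is determined by the vanishing of third differences.  The
    resulting linear relation splits symmetrically into two pairs, so the count is a
    mean square and Cauchy-Schwarz gives at least the fourth power of the mean of
    [f1] on the coset ([model_count_ge], [ap4_cond_exp_ge]).  By convexity the
    average over cosets is at least [alpha ^ 4] up to a small error.

    Replacing [f1] by [f].  If the counts of [f] and [f1] on cosets of [V] differ
    substantially, then on a positive proportion of the cosets [f - f1] correlates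
    with a quadratic phase ([ap4_inverse]).  Adjoining one polynomial for each
    coset increases the mean square of the conditional expectation by an amount
    that depends on [K] only ([energy_increment]).  A low-rank combination can be
    eliminated by refining [L], without losing energy ([drop_quadratic]).  As the
    energy is at most 1, the process stops ([popular_above_energy_holds]), after a
    number of steps, and with a codimension, bounded in terms of [K].

    Inverse theorem.  Cauchy-Schwarz bounds the count by the correlation of the
    multiplicative derivatives [f (x + h) f x] with characters [xi h]
    ([von_neumann4]).  If this is large, the graph of [xi] has large additive
    energy ([additive_energy_ge]); by Balog-Szemeredi-Gowers and a covering
    argument a positive proportion of it lies on a coset of a small
    subspace, so that [xi] can be taken affine ([linear_derivative]).  A further
    Cauchy-Schwarz shows that its matrix is symmetric up to bounded rank
    ([symmetry_defect]), and a symmetric matrix can be integrated to a quadratic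
    phase with which [f] correlates ([integrate_derivative]).

    Fourier analysis takes place over the algebraic numbers, and all bounds are
    expressed through natural numbers, so the final inequality is one between
    natural numbers and can be read in any [R]. *)

Set Implicit Arguments.
Unset Strict Implicit.
Unset Printing Implicit Defensive.

Import Order.TTheory GRing.Theory Num.Theory.
Local Open Scope ring_scope.

Local Notation F5 := 'F_5.

(** * Averages over finite groups *)

Section Mean.
Variables (C : numClosedFieldType).
Implicit Types G H : finZmodType.

Definition mean G (f : G -> C) : C := (\sum_x f x) / #|G|%:R.

End Mean.

Notation "\avg_ x F" := (mean (fun x => F))
  (at level 36, x binder, F at level 36, right associativity,
   format "\avg_ x  F") : ring_scope.

Section MeanTheory.
Variables (C : numClosedFieldType).
Implicit Types G H : finZmodType.

Lemma card_gt0 G : (0 < #|G|)%N.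
Proof. by apply/card_gt0P; exists 0. Qed.

Lemma card_neq0 G : #|G|%:R != 0 :> C.
Proof. by rewrite pnatr_eq0 -lt0n card_gt0. Qed.

Lemma eq_mean G (f g : G -> C) : f =1 g -> mean f = mean g.
Proof. by move=> fg; rewrite /mean (eq_bigr g). Qed.

Lemma mean_const G (c : C) : \avg_(x : G) c = c.
Proof. by rewrite /mean sumr_const -[c *+ _]mulr_natr mulfK ?card_neq0. Qed.

Lemma meanD G (f g : G -> C) : \avg_x (f x + g x) = \avg_x f x + \avg_x g x.
Proof. by rewrite /mean big_split mulrDl. Qed.

Lemma meanN G (f : G -> C) : \avg_x (- f x) = - \avg_x f x.
Proof. by rewrite /mean sumrN mulNr. Qed.

Lemma meanB G (f g : G -> C) : \avg_x (f x - g x) = \avg_x f x - \avg_x g x.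
Proof. by rewrite meanD meanN. Qed.

Lemma meanZl G c (f : G -> C) : \avg_x (c * f x) = c * \avg_x f x.
Proof. by rewrite /mean -mulr_sumr mulrA. Qed.

Lemma meanZr G c (f : G -> C) : \avg_x (f x * c) = (\avg_x f x) * c.
Proof. by rewrite /mean -mulr_suml mulrAC. Qed.

Lemma mean_sum G (I : finType) (P : pred I) (f : I -> G -> C) :
  \avg_x \sum_(i | P i) f i x = \sum_(i | P i) \avg_x f i x.
Proof. by rewrite /mean exchange_big mulr_suml. Qed.

Lemma exchange_mean G H (f : G -> H -> C) :
  \avg_x \avg_y f x y = \avg_y \avg_x f x y.
Proof. by rewrite /mean -!mulr_suml exchange_big mulrAC. Qed.

Lemma conj_mean G (f : G -> C) : (\avg_x f x)^* = \avg_x (f x)^*.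
Proof.
by rewrite /mean rmorphM fmorphV /= rmorph_nat rmorph_sum.
Qed.

Lemma reindex_mean G (h : G -> G) (f : G -> C) : injective h ->
  \avg_x f x = \avg_x f (h x).
Proof. by move=> inj; rewrite /mean (reindex_inj inj). Qed.

Lemma mean_shift G a (f : G -> C) : \avg_x f (x + a) = \avg_x f x.
Proof. by rewrite [RHS](reindex_mean _ (addIr a)). Qed.

Lemma ler_mean G (f g : G -> C) : (forall x, f x <= g x) ->
  \avg_x f x <= \avg_x g x.
Proof. by move=> le; rewrite ler_wpM2r ?invr_ge0 ?ler0n // ler_sum. Qed.

Lemma mean_ge0 G (f : G -> C) : (forall x, 0 <= f x) -> 0 <= \avg_x f x.
Proof. by move=> f0; rewrite -(mean_const G 0) ler_mean. Qed.

Lemma mean_le1 G (f : G -> C) : (forall x, f x <= 1) -> \avg_x f x <= 1.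
Proof. by move=> f0; rewrite -(mean_const G 1) ler_mean. Qed.

Lemma mean_real G (f : G -> C) : (forall x, f x \is Num.real) ->
  \avg_x f x \is Num.real.
Proof. by move=> fr; rewrite rpred_div ?rpred_sum ?rpred_nat. Qed.

Lemma ler_norm_mean G (f : G -> C) : `|\avg_x f x| <= \avg_x `|f x|.
Proof.
rewrite /mean normrM normfV normr_nat ler_wpM2r ?invr_ge0 ?ler0n //.
exact: ler_norm_sum.
Qed.

Lemma norm_mean_le1 G (f : G -> C) : (forall x, `|f x| <= 1) ->
  `|\avg_x f x| <= 1.
Proof. by move=> f1; apply: le_trans (ler_norm_mean _) _; apply: mean_le1. Qed.

Lemma le_of_eq (a b : C) : a = b -> a <= b.
Proof. by move=> ->. Qed.

Lemma prod_unit_interval (a b : C) : 0 <= a <= 1 -> 0 <= b <= 1 -> 0 <= a * b <= 1.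
Proof. by move=> /andP [a0 a1] /andP [b0 b1]; rewrite mulr_ge0 // mulr_ile1. Qed.

Lemma norm_sub_unit_interval (a b : C) : 0 <= a <= 1 -> 0 <= b <= 1 -> `|a - b| <= 1.
Proof.
move=> /andP [a0 a1] /andP [b0 b1].
rewrite real_ler_norml ?rpredB ?ger0_real // lerBrDr lerBlDr; apply/andP; split.
  by apply: le_trans a0; rewrite addrC subr_le0.
by rewrite (le_trans a1) // lerDl.
Qed.

Lemma prod_norm_le1 (a b : C) : `|a| <= 1 -> `|b| <= 1 -> `|a * b| <= 1.
Proof. by move=> a1 b1; rewrite normrM mulr_ile1. Qed.

Lemma sqr_mean_le G (f : G -> C) : (forall x, f x \is Num.real) ->
  (\avg_x f x) ^+ 2 <= \avg_x (f x) ^+ 2.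
Proof.
move=> fr; set m := \avg_x f x.
have mr : m \is Num.real by apply: mean_real.
have: 0 <= \avg_x (f x - m) ^+ 2.
  by apply: mean_ge0 => x; rewrite real_exprn_even_ge0 ?rpredB.
have -> : \avg_x (f x - m) ^+ 2 = \avg_x (f x ^+ 2) - m ^+ 2; last first.
  by rewrite subr_ge0.
rewrite (eq_mean (g := fun x => f x ^+ 2 - (m *+ 2) * f x + m ^+ 2)); last first.
  by move=> x /=; ring.
rewrite meanD meanB meanZl mean_const -/m; ring.
Qed.

Lemma norm_mean_sqr_le G (f : G -> C) :
  `|\avg_x f x| ^+ 2 <= \avg_x `|f x| ^+ 2.
Proof.
apply: le_trans (sqr_mean_le (fun x => normr_real _)).
by rewrite ler_sqr ?nnegrE ?mean_ge0 // ler_norm_mean.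
Qed.

(** The form of Cauchy-Schwarz used throughout: a factor [u] bounded by 1 is
    removed at the price of a square. *)
Lemma cauchy_schwarz_mean G (u v : G -> C) : (forall x, `|u x| <= 1) ->
  `|\avg_x (u x * v x)| ^+ 2 <= \avg_x `|v x| ^+ 2.
Proof.
move=> u1; apply: le_trans (norm_mean_sqr_le _) _; apply: ler_mean => x.
by rewrite ler_sqr ?nnegrE // normrM ler_piMl.
Qed.

Lemma norm_mean_sqrE G (f : G -> C) :
  `|\avg_x f x| ^+ 2 = \avg_x \avg_y (f x * (f y)^*).
Proof.
rewrite normCK conj_mean -meanZr; apply: eq_mean => x.
by rewrite -meanZl.
Qed.

Lemma mean_indic G (P : pred G) : \avg_x ((P x)%:R : C) = #|P|%:R / #|G|%:R.
Proof.
rewrite /mean -natr_sum; congr (_%:R / _).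
by rewrite -sum1_card [RHS]big_mkcond.
Qed.

(** Pigeonhole for averages: otherwise every value lies below [c], and so does
    the mean.  Both realness hypotheses serve to make the values comparable. *)
Lemma exists_ge_mean G (f : G -> C) c : (forall x, f x \is Num.real) ->
  c \is Num.real -> c <= \avg_x f x -> exists x, c <= f x.
Proof.
move=> fr cr le; apply/existsP; apply: contraT => /existsPn no.
have lt x : f x < c by rewrite real_ltNge ?no.
suff h: \avg_x f x < c by have := le_lt_trans le h; rewrite ltxx.
rewrite -(mean_const G c) /mean ltr_pM2r ?invr_gt0 ?ltr0n ?card_gt0 //.
by apply: ltr_sum => //; apply/hasP; exists 0; rewrite ?mem_index_enum.
Qed.

End MeanTheory.

(** * Characters of F_5^n *)

Definition omega : algC := sval (C_prim_root_exists (isT : (0 < 5)%N)).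

Definition echar (a : F5) : algC := omega ^+ a.

Lemma omega_prim : 5.-primitive_root omega.
Proof. by rewrite /omega; case: C_prim_root_exists. Qed.

Lemma echar0 : echar 0 = 1. Proof. by []. Qed.

Lemma echarD a b : echar (a + b) = echar a * echar b.
Proof. by rewrite /echar -exprD /= (prim_expr_mod omega_prim). Qed.

Lemma echar1_neq1 : echar 1 != 1.
Proof. by rewrite /echar -(prim_order_dvd omega_prim). Qed.

Lemma norm_echar a : `|echar a| = 1.
Proof.
apply/eqP; rewrite -(@pexpr_eq1 _ _ 5) // -normrX /echar -exprM mulnC exprM.
by rewrite (prim_expr_order omega_prim) expr1n normr1.
Qed.

Lemma norm_echar_le1 a : `|echar a| <= 1.
Proof. by rewrite norm_echar. Qed.

Lemma echarN a : echar (- a) = (echar a)^*.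
Proof.
have ne0 : echar a != 0 by rewrite -normr_eq0 norm_echar oner_eq0.
apply: (mulfI ne0); rewrite -echarD subrr echar0 -normCK norm_echar expr1n //.
Qed.

Lemma echarB a b : echar (a - b) = echar a * (echar b)^*.
Proof. by rewrite echarD echarN. Qed.

Definition dot n (x y : 'rV[F5]_n) : F5 := (x *m y^T) 0 0.

Lemma dotE n (x y : 'rV[F5]_n) : dot x y = \sum_i x 0 i * y 0 i.
Proof. by rewrite /dot mxE; apply: eq_bigr => i _; rewrite mxE. Qed.

Lemma dotC n (x y : 'rV_n) : dot x y = dot y x.
Proof. by rewrite /dot -[in RHS](trmxK y) -[in RHS]trmx_mul [RHS]mxE. Qed.

Lemma dotDl n (x y z : 'rV_n) : dot (x + y) z = dot x z + dot y z.
Proof. by rewrite /dot mulmxDl mxE. Qed.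
Lemma dotDr n (x y z : 'rV_n) : dot z (x + y) = dot z x + dot z y.
Proof. by rewrite dotC dotDl !(dotC _ z). Qed.
Lemma dotNl n (x z : 'rV_n) : dot (- x) z = - dot x z.
Proof. by rewrite /dot mulNmx mxE. Qed.
Lemma dotNr n (x z : 'rV_n) : dot z (- x) = - dot z x.
Proof. by rewrite dotC dotNl dotC. Qed.
Lemma dotBl n (x y z : 'rV_n) : dot (x - y) z = dot x z - dot y z.
Proof. by rewrite dotDl dotNl. Qed.
Lemma dotBr n (x y z : 'rV_n) : dot z (x - y) = dot z x - dot z y.
Proof. by rewrite dotDr dotNr. Qed.
Lemma dotZl n a (x z : 'rV_n) : dot (a *: x) z = a * dot x z.
Proof. by rewrite /dot -scalemxAl mxE. Qed.
Lemma dotZr n a (x z : 'rV_n) : dot z (a *: x) = a * dot z x.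
Proof. by rewrite dotC dotZl dotC. Qed.
Lemma dot0l n (z : 'rV_n) : dot 0 z = 0.
Proof. by rewrite /dot mul0mx mxE. Qed.
Lemma dot0r n (z : 'rV_n) : dot z 0 = 0.
Proof. by rewrite dotC dot0l. Qed.
Lemma dot_mulmx n m (x : 'rV_n) (M : 'M_(n, m)) y :
  dot (x *m M) y = dot x (y *m M^T).
Proof. by rewrite /dot trmx_mul trmxK mulmxA. Qed.

(** Orthogonality of characters: if [v] is nonzero some [x0] has
    [dot x0 v = 1], and translating [x] by [x0] multiplies the average by
    [echar 1], which is not 1. *)
Lemma mean_echar n (v : 'rV_n) : \avg_x echar (dot x v) = (v == 0)%:R.
Proof.
case: eqP => [->|/eqP vn0].
  by rewrite (eq_mean (g := fun=> 1)) ?mean_const // => x; rewrite dot0r.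
have [x0 x0v] : exists x0, dot x0 v = 1.
  have [i vi] : exists i, v 0 i != 0.
    apply/existsP; apply: contraNT vn0 => /existsPn z; apply/eqP/rowP => i.
    by rewrite mxE; apply/eqP; rewrite -[_ == _]negbK z.
  exists ((v 0 i)^-1 *: delta_mx 0 i).
  by rewrite dotZl /dot -rowE !mxE mulVf.
have : (echar 1 - 1) * \avg_x echar (dot x v) = 0.
  rewrite mulrBl mul1r -meanZl -[X in _ - X](mean_shift x0); apply/eqP.
  rewrite subr_eq0; apply/eqP/eq_mean => x.
  by rewrite dotDl x0v echarD mulrC.
by move/eqP; rewrite mulf_eq0 subr_eq0 (negbTE echar1_neq1) => /eqP.
Qed.

Definition fourier n (f : 'rV[F5]_n -> algC) (xi : 'rV_n) : algC :=
  \avg_x (f x * echar (- dot x xi)).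

Lemma card_rV n : #|{: 'rV[F5]_n}| = (5 ^ n)%N.
Proof. by rewrite card_mx card_Fp // mul1n. Qed.

Lemma sum_mean n (f : 'rV[F5]_n -> algC) :
  \sum_x f x = (5 ^ n)%:R * \avg_x f x.
Proof. by rewrite /mean -card_rV mulrC divfK // card_neq0. Qed.

Lemma sum_echar n (v : 'rV_n) :
  \sum_x echar (dot v x) = (5 ^ n)%:R * (v == 0)%:R.
Proof.
by rewrite sum_mean -mean_echar; congr (_ * _); apply: eq_mean => x; rewrite dotC.
Qed.

Lemma mean_delta n (y : 'rV[F5]_n) (f : 'rV_n -> algC) :
  \avg_x (f x * (x == y)%:R) = f y / (5 ^ n)%:R.
Proof.
rewrite /mean (bigD1 y) //= eqxx mulr1 big1 ?addr0 ?card_rV // => x /negbTE ->.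
by rewrite mulr0.
Qed.

Lemma parseval n (f : 'rV[F5]_n -> algC) :
  \sum_xi `|fourier f xi| ^+ 2 = \avg_x `|f x| ^+ 2.
Proof.
pose g x y := f x * (f y)^*.
transitivity (\sum_xi \avg_x \avg_y (g x y * echar (dot (y - x) xi))).
  apply: eq_bigr => xi _; rewrite norm_mean_sqrE.
  apply: eq_mean => x; apply: eq_mean => y.
  by rewrite rmorphM /= -echarN opprK dotBl echarB echarN /g; ring.
rewrite -mean_sum; apply: eq_mean => x; rewrite -mean_sum.
rewrite (eq_mean (g := fun y => (5 ^ n)%:R * (g x y * (y == x)%:R))).
  rewrite meanZl mean_delta mulrC divfK; first by rewrite normCK.
  by rewrite -card_rV card_neq0.
by move=> y; rewrite -mulr_sumr sum_echar subr_eq0; ring.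
Qed.

Lemma exists_max (T : finType) (x0 : T) (f : T -> algC) :
  (forall x, f x \is Num.real) -> exists x, forall y, f y <= f x.
Proof.
move=> fr; case: (@real_arg_maxP _ _ x0 predT f) => // x _ h.
by exists x => y; apply: h.
Qed.

Lemma norm_fourier_le1 n (f : 'rV[F5]_n -> algC) xi : (forall x, `|f x| <= 1) ->
  `|fourier f xi| <= 1.
Proof.
move=> f1; apply: norm_mean_le1 => x.
by apply: prod_norm_le1 => //; apply: norm_echar_le1.
Qed.

(** The function averaged on the left is a convolution, so Parseval turns the
    average into a sum of products [|fourier a z|^2 |fourier b' z|^2] with [b']
    the conjugate of [b]; the first factor is at most its maximum and the
    second sums to at most 1. *)
Lemma conv_fourier_max n (a b : 'rV[F5]_n -> algC) : (forall x, `|b x| <= 1) ->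
  exists xi, \avg_h `|\avg_x (a (x + h) * b x)| ^+ 2 <= `|fourier a xi| ^+ 2.
Proof.
move=> b1.
have [xi maxi] := @exists_max _ (0 : 'rV_n) (fun xi => `|fourier a xi| ^+ 2)
  (fun _ => rpredX _ (normr_real _)).
exists xi; rewrite -parseval.
pose b' x := (b x)^*.
apply: (@le_trans _ _ (\sum_z `|fourier a xi| ^+ 2 * `|fourier b' z| ^+ 2)).
  apply: ler_sum => z _.
  have -> : fourier (fun h => \avg_x (a (x + h) * b x)) z
            = fourier a z * (fourier b' z)^*.
    rewrite /fourier conj_mean -meanZl.
    rewrite (eq_mean (g := fun h => \avg_x (a (x + h) * b x * echar (- dot h z))));
      last by move=> h; rewrite meanZr.
    rewrite exchange_mean; apply: eq_mean => x.
    rewrite -meanZr -[RHS](mean_shift x); apply: eq_mean => h.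
    rewrite /b' rmorphM /= conjCK -echarN opprK (addrC x) !echarN dotDl echarD.
    rewrite rmorphM /=.
    have: echar (dot x z) * (echar (dot x z))^* = 1.
      by rewrite -normCK norm_echar expr1n.
    by move=> e1; rewrite -[LHS]mulr1 -{}e1; ring.
  by rewrite normrM norm_conjC exprMn ler_wpM2r ?exprn_ge0.
rewrite -mulr_sumr parseval ler_piMr ?exprn_ge0 // mean_le1 // => x.
by rewrite /b' norm_conjC exprn_ile1.
Qed.

(** * The generalised von Neumann inequality *)

(** One step of Weyl differencing: the bounded factor in [x] alone disappears
    and the remaining function is replaced by its multiplicative derivative
    in the variable [d]. *)
Lemma cauchy_schwarz_diff (G H : finZmodType) (u : G -> algC) (g : G -> H -> algC) :
  (forall x, `|u x| <= 1) ->
  `|\avg_x \avg_d (u x * g x d)| ^+ 2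
    <= \avg_x \avg_d \avg_h (g x d * (g x (d + h))^*).
Proof.
move=> u1.
rewrite (eq_mean (g := fun x => u x * \avg_d g x d)); last first.
  by move=> x; rewrite meanZl.
apply: le_trans (cauchy_schwarz_mean _ u1) _; apply: ler_mean => x.
rewrite norm_mean_sqrE; apply: le_of_eq.
apply: eq_mean => d; rewrite -[LHS](mean_shift d).
by apply: eq_mean => h; rewrite addrC.
Qed.

Lemma scaler_inj_F5 n (c : F5) : c != 0 -> injective (fun x : 'rV[F5]_n => c *: x).
Proof. by move=> c0; apply: can_inj (scalerK c0). Qed.

Lemma mean_scale n (c : F5) (f : 'rV[F5]_n -> algC) : c != 0 ->
  \avg_x f (c *: x) = \avg_x f x.
Proof. by move=> c0; rewrite [RHS](reindex_mean _ (scaler_inj_F5 c0)). Qed.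

Lemma mean_affine n (c : F5) y (f : 'rV[F5]_n -> algC) : c != 0 ->
  \avg_x f (y + c *: x) = \avg_x f x.
Proof.
move=> c0; rewrite (mean_scale (fun x => f (y + x)) c0) -[RHS](mean_shift y).
by apply: eq_mean => x; rewrite addrC.
Qed.

(** Differencing once leaves, for each shift [u], a product of two independent
    averages, one of them the autocorrelation of [f2]; a second Cauchy-Schwarz
    keeps only that one, whose mean square is at most the largest squared
    Fourier coefficient of [f2] by [conv_fourier_max]. *)
Lemma von_neumann3 n (b c : F5) (f0 f1 f2 : 'rV[F5]_n -> algC) :
  c != 0 -> c != b ->
  (forall x, `|f0 x| <= 1) -> (forall x, `|f1 x| <= 1) ->
  (forall x, `|f2 x| <= 1) ->
  exists xi, `|\avg_x \avg_d (f0 x * f1 (x + b *: d) * f2 (x + c *: d))| ^+ 4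
    <= `|fourier f2 xi| ^+ 2.
Proof.
move=> c0 cb f01 f11 f21.
have [|xi hxi] := @conv_fourier_max n f2 (fun x => (f2 x)^*).
  by move=> x; rewrite norm_conjC.
exists xi; apply: le_trans hxi.
pose D (f : 'rV[F5]_n -> algC) (e : F5) (h x : 'rV_n) := f x * (f (x + e *: h))^*.
pose S := \avg_h (\avg_x D f1 b h x * \avg_x D f2 c h x).
have le1 : `|\avg_x \avg_d (f0 x * f1 (x + b *: d) * f2 (x + c *: d))| ^+ 2 <= S.
  under eq_mean => x do under eq_mean => d do rewrite -mulrA.
  apply: le_trans (cauchy_schwarz_diff _ f01) _.
  rewrite exchange_mean.
  rewrite (eq_mean (g := fun d => \avg_h \avg_x (D f1 b h x * D f2 c h (x + (c - b) *: d)))).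
    rewrite exchange_mean; apply: le_of_eq; apply: eq_mean => h.
    rewrite exchange_mean -meanZr; apply: eq_mean => x.
    by rewrite meanZl mean_affine // subr_eq0.
  move=> d; rewrite exchange_mean; apply: eq_mean => h.
  rewrite -(mean_shift (- (b *: d))); apply: eq_mean => x.
  rewrite /D rmorphM /= subrK scalerBl !scalerDr.
  have -> : x - b *: d + (b *: d + b *: h) = x + b *: h by rewrite addrA subrK.
  have -> : x - b *: d + c *: d = x + (c *: d - b *: d) by rewrite -addrA (addrC (- _)).
  have -> : x - b *: d + (c *: d + c *: h) = x + (c *: d - b *: d) + c *: h.
    by rewrite !addrA; congr (_ + _); rewrite -!addrA; congr (_ + _); rewrite addrC.
  by ring.
have le2 : `|S| ^+ 2 <= \avg_h `|\avg_x D f2 c h x| ^+ 2.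
  apply: cauchy_schwarz_mean => h; apply: norm_mean_le1 => x; apply: prod_norm_le1 => //.
  by rewrite norm_conjC.
have -> : \avg_h `|\avg_x (f2 (x + h) * (f2 x)^*)| ^+ 2
        = \avg_h `|\avg_x D f2 c h x| ^+ 2.
  rewrite -[LHS](mean_scale _ c0); apply: eq_mean => h.
  rewrite -[in RHS]norm_conjC conj_mean; congr (`|_| ^+ 2); apply: eq_mean => x.
  by rewrite /D rmorphM /= conjCK mulrC.
apply: le_trans le2; rewrite (exprM _ 2 2) ler_sqr ?nnegrE ?exprn_ge0 //.
apply: (le_trans le1); apply: real_ler_norm.
by apply: ger0_real; apply: le_trans le1; rewrite exprn_ge0.
Qed.

(** Differencing removes [f0] and leaves, for every shift [h], a three-term
    average of multiplicative derivatives, to which [von_neumann3] applies.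
    The frequency [xi h] depends on [h]: the right-hand side is a version of
    the Gowers U^3 norm of [f3]. *)
Lemma von_neumann4 n (c0 c1 c2 c3 : F5) (f0 f1 f2 f3 : 'rV[F5]_n -> algC) :
  c3 != c0 -> c3 != c1 -> c3 != c2 ->
  (forall x, `|f0 x| <= 1) -> (forall x, `|f1 x| <= 1) ->
  (forall x, `|f2 x| <= 1) -> (forall x, `|f3 x| <= 1) ->
  (forall x, f3 x \is Num.real) ->
  exists xi : 'rV_n -> 'rV_n,
  `|\avg_x \avg_d (f0 (x + c0 *: d) * f1 (x + c1 *: d) *
      f2 (x + c2 *: d) * f3 (x + c3 *: d))| ^+ 8
    <= \avg_h `|\avg_x (f3 (x + h) * f3 x * echar (- dot x (xi h)))| ^+ 2.
Proof.
move=> n0 n1 n2 f01 f11 f21 f31 fr.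
pose D (f : 'rV[F5]_n -> algC) (e : F5) (h x : 'rV_n) := f x * (f (x + e *: h))^*.
have D1 f e h x : (forall x, `|f x| <= 1) -> `|D f e h x| <= 1.
  by move=> fle1; apply: prod_norm_le1 => //; rewrite norm_conjC.
pose e1 := c1 - c0; pose e2 := c2 - c0; pose e3 := c3 - c0.
pose L h := \avg_x \avg_d (D f1 e1 h x * D f2 e2 h (x + (c2 - c1) *: d)
                * D f3 e3 h (x + (c3 - c1) *: d)).
have e30 : e3 != 0 by rewrite subr_eq0.
have exi h : exists xi, `|L (e3^-1 *: h)| ^+ 4 <= `|fourier (D f3 e3 (e3^-1 *: h)) xi| ^+ 2.
  apply: von_neumann3; rewrite ?subr_eq0 //; try by move=> x; apply: D1.
  by apply: contraNneq n2 => /addIr ->.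
exists (fun h => xchoose (exi h)).
set X := \avg_x _.
have le1 : `|X| ^+ 2 <= \avg_h L h.
  have -> : X = \avg_x \avg_d (f0 x *
      (f1 (x + e1 *: d) * f2 (x + e2 *: d) * f3 (x + e3 *: d))).
    rewrite /X exchange_mean [RHS]exchange_mean; apply: eq_mean => d.
    rewrite -(mean_shift (- (c0 *: d))); apply: eq_mean => x.
    have E (e : F5) : x - c0 *: d + e *: d = x + (e - c0) *: d.
      by rewrite scalerBl -addrA (addrC (- _)).
    by rewrite !E subrr scale0r addr0 -!mulrA.
  apply: le_trans (cauchy_schwarz_diff _ f01) _.
  rewrite exchange_mean.
  rewrite (eq_mean (g := fun d => \avg_h \avg_x (D f1 e1 h x *
     D f2 e2 h (x + (c2 - c1) *: d) * D f3 e3 h (x + (c3 - c1) *: d)))).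
    rewrite exchange_mean; apply: le_of_eq; apply: eq_mean => h.
    by rewrite exchange_mean.
  move=> d; rewrite exchange_mean; apply: eq_mean => h.
  rewrite -(mean_shift (- (e1 *: d))); apply: eq_mean => x.
  have E (e : F5) : x - e1 *: d + e *: d = x + (e - e1) *: d.
    by rewrite (scalerBl e) -addrA (addrC (- _)).
  have E' (e : F5) : x - e1 *: d + e *: (d + h) = x + (e - e1) *: d + e *: h.
    by rewrite scalerDr addrA E.
  have -> : c2 - c1 = e2 - e1 by rewrite /e1 /e2; ring.
  have -> : c3 - c1 = e3 - e1 by rewrite /e1 /e3; ring.
  rewrite !E !E' subrr scale0r addr0 /D !rmorphM /=; ring.
have le2 : `|\avg_h L h| ^+ 2 <= \avg_h `|L h| ^+ 2 by apply: norm_mean_sqr_le.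
have le3 : (\avg_h `|L h| ^+ 2) ^+ 2 <= \avg_h `|L h| ^+ 4.
  apply: le_trans (sqr_mean_le _) _; first by move=> h; rewrite rpredX ?normr_real.
  by apply: ler_mean => h; rewrite -exprM.
apply: (@le_trans _ _ (\avg_h `|L h| ^+ 4)).
  have Lge0 : 0 <= \avg_h `|L h| ^+ 2 by apply: mean_ge0 => h; rewrite exprn_ge0.
  apply: le_trans le3; rewrite (exprM _ 4 2) ler_sqr ?nnegrE ?exprn_ge0 //.
  apply: le_trans le2; rewrite (exprM _ 2 2) ler_sqr ?nnegrE ?exprn_ge0 //.
  apply: (le_trans le1); apply: real_ler_norm.
  by apply: ger0_real; apply: le_trans le1; rewrite exprn_ge0.
have -> : \avg_h `|L h| ^+ 4 = \avg_h `|L (e3^-1 *: h)| ^+ 4.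
  by rewrite [RHS](mean_scale (fun h => `|L h| ^+ 4)) // invr_eq0.
apply: ler_mean => h; apply: le_trans (xchooseP (exi h)) _.
apply: le_of_eq; congr (`|_| ^+ 2).
move: (xchoose _) => xi; apply: eq_mean => x; rewrite /D scalerA divff // scale1r.
by rewrite (CrealP (fr _)) [f3 x * _]mulrC.
Qed.

(** * The Balog-Szemeredi-Gowers theorem *)

Section BSG.
Local Open Scope nat_scope.
Variable G : finZmodType.
Implicit Types (A : {set G}).

Definition rep A (d : G) : nat := \sum_(x in A) ((x - d)%R \in A).

Definition conv (u v : G -> nat) (d : G) : nat := \sum_x u x * v (d - x)%R.

Definition diffset A : {set G} := [set (p.1 - p.2)%R | p in setX A A].

Lemma card_set_sum A (p : pred G) : #|[set x in A | p x]| = \sum_(x in A) p x.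
Proof.
rewrite -sum1_card big_mkcond [RHS]big_mkcond; apply: eq_bigr => x _.
by rewrite inE; case: (x \in A); case: (p x).
Qed.

Lemma sum_conv u v : \sum_d conv u v d = (\sum_x u x) * (\sum_x v x).
Proof.
rewrite /conv exchange_big /= big_distrl; apply: eq_bigr => x _.
by rewrite -big_distrr /= [in RHS](reindex_inj (addIr (- x)%R)).
Qed.

Lemma conv_sym u v d : (forall x, u (- x)%R = u x) -> (forall x, v (- x)%R = v x) ->
  conv u v (- d)%R = conv u v d.
Proof.
move=> su sv; rewrite /conv (reindex_inj oppr_inj); apply: eq_bigr => x _.
by rewrite su -[in RHS]sv opprB opprK addrC.
Qed.

Lemma rep_le A d : rep A d <= #|A|.
Proof. by rewrite -sum1_card leq_sum // => x _; case: (_ \in _). Qed.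

Lemma rep_sym A d : rep A (- d)%R = rep A d.
Proof.
rewrite /rep big_mkcond [RHS]big_mkcond (reindex_inj (addIr (- d)%R)) /=.
apply: eq_bigr => x _; rewrite opprK subrK.
by case: (x \in A); case: (_ \in A).
Qed.

(** Both sides count the edges of the graph joining [a] and [v] when [P (a - v)]. *)
Lemma sum_rep_cond A (P : pred G) :
  \sum_(d | P d) rep A d = \sum_(v in A) \sum_(a in A) P (a - v)%R.
Proof.
rewrite /rep exchange_big /= [RHS]exchange_big /=; apply: eq_bigr => a _.
rewrite big_mkcond [RHS]big_mkcond [RHS](reindex_inj (can_inj (subKr a))) /=.
by apply: eq_bigr => d _; rewrite subKr; case: (P d); case: (_ \in A).
Qed.

Lemma sum_rep A : \sum_d rep A d = #|A| ^ 2.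
Proof.
rewrite (sum_rep_cond A predT) /=.
rewrite (eq_bigr (fun=> #|A|)); last by move=> v _; rewrite sum1_card.
by rewrite sum_nat_const.
Qed.

Lemma sqr_sum_le (I : finType) (P : pred I) (f : I -> nat) (n : nat) :
  #|P| <= n -> (\sum_(i | P i) f i) ^ 2 <= n * \sum_(i | P i) f i ^ 2.
Proof.
move=> Pn; apply: (@leq_trans (#|P| * \sum_(i | P i) f i ^ 2)); last first.
  by rewrite leq_mul2r Pn orbT.
suff: 2 * (\sum_(i | P i) f i) ^ 2 <= 2 * (#|P| * \sum_(i | P i) f i ^ 2).
  by rewrite leq_pmul2l.
have -> : 2 * (\sum_(i | P i) f i) ^ 2 = \sum_(i | P i) \sum_(j | P j) 2 * (f i * f j).
  rewrite -mulnn big_distrlr /= big_distrr; apply: eq_bigr => i _.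
  by rewrite big_distrr.
have -> : 2 * (#|P| * \sum_(i | P i) f i ^ 2)
          = \sum_(i | P i) \sum_(j | P j) (f i ^ 2 + f j ^ 2).
  rewrite [RHS](eq_bigr (fun i => #|P| * f i ^ 2 + \sum_(j | P j) f j ^ 2)).
    by rewrite big_split /= -big_distrr /= sum_nat_const mul2n addnn.
  by move=> i _; rewrite big_split sum_nat_const.
by apply: leq_sum => i _; apply: leq_sum => j _; apply: nat_Cauchy.
Qed.

Variables (A : {set G}) (N K : nat).
Hypotheses (N0 : 0 < N) (AN : #|A| <= N).

Let K1 := 2 * K.
Let P d := N <= K1 * rep A d.
(* The threshold for common neighbours, low enough for bad pairs to make up at
   most an eighth of the pairs of some large neighbourhood. *)
Let T := 16 * K1 ^ 2.
Let codeg a b := \sum_(v in A) (P (a - v)%R && P (b - v)%R).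
Let bad a b := codeg a b * T < N.
Let Nb v := [set a in A | P (a - v)%R].
Let nbad v := \sum_(a in Nb v) \sum_(b in Nb v) bad a b.

(** Differences that are not popular contribute at most half of the additive
    energy, and each popular one has at most [N] representations, so the graph
    on [A] whose edges are the pairs with popular difference is dense. *)
Lemma popular_edges : N ^ 3 <= K * \sum_d rep A d ^ 2 ->
  N ^ 2 <= K1 * \sum_(v in A) #|Nb v|.
Proof.
move=> hE.
have low : K1 * \sum_(d | ~~ P d) rep A d ^ 2 <= N * N ^ 2.
  apply: (@leq_trans (N * \sum_d rep A d)); last first.
    by rewrite sum_rep leq_mul2l leq_sqr AN orbT.
  rewrite [\sum_d rep A d](bigID P) /= mulnDr -[X in X <= _]add0n leq_add //.
  rewrite !big_distrr /=; apply: leq_sum => d; rewrite /P -ltnNge => lt.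
  by rewrite expnS expn1 mulnA leq_mul2r (ltnW lt) orbT.
have high : \sum_(d | P d) rep A d ^ 2 <= N * \sum_(v in A) #|Nb v|.
  rewrite [X in _ <= _ * X](eq_bigr (fun v => \sum_(a in A) P (a - v)%R)); last first.
    by move=> v _; rewrite card_set_sum.
  rewrite -sum_rep_cond big_distrr /=; apply: leq_sum => d _.
  by rewrite expnS expn1 leq_mul2r (leq_trans (rep_le _ _) AN) orbT.
have : N * N ^ 2 <= N * (K1 * \sum_(v in A) #|Nb v|); last by rewrite leq_pmul2l.
move: hE; rewrite (bigID P) /= => hE.
apply: (@leq_trans (K1 * \sum_(d | P d) rep A d ^ 2)); last first.
  by rewrite mulnCA leq_mul2l high orbT.
have NN : N ^ 3 = N * N ^ 2 by rewrite expnS.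
move: low hE; rewrite -NN /K1; move: (N ^ 3) => n3.
move: (\sum_(d | P d) _) (\sum_(d | ~~ P d) _) => a b; clear; nia.
Qed.

(** Dependent random choice: on average over [v], the neighbourhood [Nb v]
    is large in mean square, while a pair with few common neighbours lies in
    few neighbourhoods.  Hence some neighbourhood is large and has few bad
    pairs. *)
Lemma exists_good_vertex : N ^ 3 <= K * \sum_d rep A d ^ 2 ->
  exists2 v, N <= 2 * K1 * #|Nb v| & 8 * nbad v <= #|Nb v| ^ 2.
Proof.
move=> hE; have E := popular_edges hE.
have E2 : N ^ 3 <= K1 ^ 2 * \sum_(v in A) #|Nb v| ^ 2.
  have cs := @sqr_sum_le G (mem A) (fun v => #|Nb v|) N AN.
  have : N * N ^ 3 <= N * (K1 ^ 2 * \sum_(v in A) #|Nb v| ^ 2); last first.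
    by rewrite leq_pmul2l.
  rewrite mulnCA; apply: leq_trans (leq_mul (leqnn _) cs).
  by rewrite -expnMn -expnS (expnM N 2 2) leq_sqr.
have Ebad : T * \sum_(v in A) nbad v <= N ^ 3.
  have -> : \sum_(v in A) nbad v = \sum_(a in A) \sum_(b in A) bad a b * codeg a b.
    transitivity (\sum_(v in A) \sum_(a in A) \sum_(b in A)
        bad a b * (P (a - v)%R && P (b - v)%R)).
      apply: eq_bigr => v _; rewrite /nbad big_mkcond [RHS]big_mkcond /=.
      apply: eq_bigr => a _; rewrite inE; case: (a \in A) => //=.
      case: (P (a - v)%R) => /=; last by rewrite big1 // => b _; rewrite muln0.
      rewrite big_mkcond [RHS]big_mkcond /=.
      apply: eq_bigr => b _; rewrite inE; case: (b \in A) => //=.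
      by case: (P (b - v)%R); rewrite ?muln0 ?muln1.
    rewrite exchange_big; apply: eq_bigr => a _.
    rewrite exchange_big; apply: eq_bigr => b _.
    by rewrite big_distrr.
  rewrite big_distrr /=; apply: (@leq_trans (\sum_(a in A) \sum_(b in A) N)).
    apply: leq_sum => a _; rewrite big_distrr; apply: leq_sum => b _ /=.
    rewrite /bad; case: ltnP; rewrite ?muln0 // mul1n mulnC; exact: ltnW.
  rewrite !sum_nat_const !expnS expn0 muln1 mulnA.
  by rewrite -!mulnA !leq_mul.
(* Summed over [v] in [A] the left-hand side is at most [2 * N ^ 3] and the
   right-hand side at least that. *)
have [v vA hv] : exists2 v, v \in A & N ^ 2 + T * nbad v <= 2 * K1 ^ 2 * #|Nb v| ^ 2.
  apply/exists_inP; apply: contraT => /exists_inPn h.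
  have : \sum_(v in A) (2 * K1 ^ 2 * #|Nb v| ^ 2 + 1) <=
         \sum_(v in A) (N ^ 2 + T * nbad v).
    by apply: leq_sum => v vA; rewrite addn1 ltnNge h.
  rewrite !big_split /= (sum_nat_const _ (N ^ 2)) -!big_distrr /= sum1_card.
  have [A0|Apos] := posnP #|A|.
    have : N ^ 3 <= 0.
      apply: leq_trans E2 _; rewrite big1 ?muln0 // => v.
      by rewrite (cards0_eq A0) inE.
    by rewrite leqNgt expn_gt0 N0.
  have : #|A| * N ^ 2 <= N ^ 3 by rewrite [N ^ 3]expnS leq_mul2r AN orbT.
  rewrite -(mulnA 2 (K1 ^ 2)); move: E2 Ebad Apos.
  move: (N ^ 3) (K1 ^ 2 * _) (T * _) (#|A| * N ^ 2) => a b c d; clear; lia.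
exists v; last by move: hv; rewrite /T; clear -N0; nia.
have : N ^ 2 <= (2 * K1 * #|Nb v|) ^ 2.
  by rewrite !expnMn; move: hv; clear; nia.
by rewrite leq_sqr.
Qed.

Definition rep2 := conv (rep A) (rep A).
Definition rep4 := conv rep2 rep2.

Let L := T * K1 ^ 2.

(** A pair that is not bad has many common neighbours [v], and each gives
    a decomposition of [a - c] into two popular differences. *)
Lemma rep2_ge a c : ~~ bad a c -> N ^ 3 <= L * rep2 (a - c)%R.
Proof.
rewrite /bad -leqNgt => gd.
have le : codeg a c * N ^ 2 <= K1 ^ 2 * rep2 (a - c)%R.
  rewrite /rep2 /conv [\sum_x _](reindex_inj (can_inj (subKr a))) /=.
  rewrite /codeg big_distrl big_distrr big_mkcond /=; apply: leq_sum => v _.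
  case: (v \in A) => //.
  rewrite -[rep A (_ - (a - v))%R]rep_sym.
  have -> : (- (a - c - (a - v)) = c - v)%R.
    by rewrite !opprB addrC addrA subrK.
  case p1: (P (a - v)%R) => //=; case p2: (P (c - v)%R) => //=.
  by rewrite mul1n -!mulnn mulnACA leq_mul.
rewrite /L; apply: (@leq_trans (codeg a c * T * N ^ 2)).
  by rewrite expnS leq_mul2r gd orbT.
by rewrite mulnAC -[T * _ * _]mulnA mulnC leq_mul2l le orbT.
Qed.

Lemma rep2_sym d : rep2 (- d)%R = rep2 d.
Proof. by apply: conv_sym => x; apply: rep_sym. Qed.

Lemma sum_rep4_le : \sum_d rep4 d <= N ^ 8.
Proof.
by rewrite /rep4 sum_conv /rep2 sum_conv sum_rep -!expnD leq_exp2r.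
Qed.

Let K2 := 4 * K1 * L ^ 2.

Lemma card_diffset_le (B : {set G}) :
  (forall a b, a \in B -> b \in B -> N ^ 7 <= K2 * rep4 (a - b)%R) ->
  #|diffset B| <= K2 * N.
Proof.
move=> h.
have : #|diffset B| * N ^ 7 <= K2 * N ^ 8.
  rewrite -sum_nat_const; apply: leq_trans (leq_mul (leqnn K2) sum_rep4_le).
  rewrite big_distrr /= big_mkcond; apply: leq_sum => d _.
  case: ifP => // /imsetP [[a b]]; rewrite inE /= => /andP [aB bB] ->.
  exact: h.
by rewrite (expnS N 7) mulnA leq_pmul2r ?expn_gt0 ?N0.
Qed.

(** In the neighbourhood found by [exists_good_vertex], keep the set [B] of
    elements lying in few bad pairs.  Any two elements of [B] have a common good
    partner [c] in many ways, so every difference of [B] has about [N^7]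
    representations as a combination of eight elements of [A]; as there are
    only [N^8] such combinations, there are few differences. *)
Lemma balog_szemeredi_gowers : N ^ 3 <= K * \sum_d rep A d ^ 2 ->
  exists2 B : {set G}, B \subset A &
    N <= 4 * K1 * #|B| /\ #|diffset B| <= K2 * N.
Proof.
move=> /exists_good_vertex [v hN hbad].
pose A1 := Nb v; pose beta a := \sum_(b in A1) bad a b.
pose B := [set a in A1 | 4 * beta a <= #|A1|].
have A1A : A1 \subset A by apply/subsetP => x; rewrite inE => /andP [].
have BA1 : B \subset A1 by apply/subsetP => x; rewrite [x \in B]inE => /andP [].
have cB : #|A1| <= 2 * #|B|.
  have h1 : #|A1 :\: B| * #|A1| <= 4 * nbad v.
    rewrite -sum_nat_const /nbad -/A1 big_distrr /= big_mkcond [X in _ <= X]big_mkcond /=.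
    apply: leq_sum => a _; rewrite in_setD; case aA1: (a \in A1); rewrite ?andbF //= andbT.
    rewrite [a \in B]inE aA1 /=.
    by case: (leqP (4 * beta a)) => // lt; apply: ltnW.
  have h2 : #|A1 :\: B| + #|B| = #|A1|.
    by rewrite -(cardsID B A1) (setIidPr BA1) addnC.
  have h3 : 8 * nbad v <= #|A1| ^ 2 by [].
  have [->//|pos] := posnP #|A1|.
  have h4 : 2 * #|A1 :\: B| * #|A1| <= #|A1| * #|A1|.
    by rewrite mulnn; move: h1 h3; clear; nia.
  rewrite leq_pmul2r // in h4; lia.
exists B; first exact: subset_trans BA1 A1A.
split; first by move: hN cB; rewrite -/A1; clear; nia.
apply: card_diffset_le => a b.
rewrite [a \in B]inE => /andP [aA1 ha]; rewrite [b \in B]inE => /andP [bA1 hb].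
pose good c := ~~ bad a c && ~~ bad b c.
have hgood : #|A1| <= 2 * \sum_(c in A1) good c.
  have : #|A1| <= beta a + beta b + \sum_(c in A1) good c.
    rewrite /beta -!big_split -sum1_card /=; apply: leq_sum => c _.
    by rewrite /good; case: (bad a c); case: (bad b c).
  by move: ha hb; clear; lia.
(* Each good [c] splits [a - b] as [(a - c) + (c - b)]. *)
have ht : N ^ 6 * \sum_(c in A1) good c <= L ^ 2 * rep4 (a - b)%R.
  rewrite /rep4 /conv [\sum_x _](reindex_inj (can_inj (subKr a))) /=.
  rewrite !big_distrr big_mkcond /=; apply: leq_sum => c _.
  case: (c \in A1) => //; rewrite -[rep2 (a - b - _)%R]rep2_sym.
  have -> : (- (a - b - (a - c)) = b - c)%R.
    by rewrite !opprB addrC addrA subrK.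
  rewrite /good; case: (boolP (bad a c)) => /= [|/rep2_ge h1]; first by rewrite muln0.
  case: (boolP (bad b c)) => /= [|/rep2_ge h2]; first by rewrite muln0.
  by rewrite muln1 (expnD N 3 3) -mulnn mulnACA leq_mul.
have -> : N ^ 7 = N * N ^ 6 by rewrite expnS.
apply: leq_trans (leq_mul hN (leqnn _)) _; rewrite -/A1.
rewrite /K2; move: ht hgood; move: (N ^ 6) (L ^ 2) (rep4 _) (\sum_(_ in _) _) => n l y g.
move: #|A1| => a1; clear; move=> h1 h2.
apply: (@leq_trans (4 * K1 * (n * g))).
  have -> : 4 * K1 * (n * g) = 2 * K1 * (2 * g) * n by ring.
  by rewrite leq_mul // leq_mul.
by rewrite -(mulnA (4 * K1)) leq_mul2l h1 orbT.
Qed.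

End BSG.

(** * Popular differences of a set with few differences *)

Section Sumset.
Local Open Scope nat_scope.
Variable G : finZmodType.

Definition sumset (A B : {set G}) : {set G} := [set (p.1 + p.2)%R | p in setX A B].

Lemma sumsetP (A B : {set G}) x :
  reflect (exists a b, [/\ a \in A, b \in B & x = (a + b)%R]) (x \in sumset A B).
Proof.
apply: (iffP imsetP) => [[[a b]]|[a [b [aA bB ->]]]].
  by rewrite inE => /andP [aA bB] ->; exists a, b.
by exists (a, b) => //; rewrite inE aA.
Qed.

Lemma mem_sumset (A B : {set G}) a b :
  a \in A -> b \in B -> (a + b)%R \in sumset A B.
Proof. by move=> aA bB; apply/sumsetP; exists a, b. Qed.

Lemma sub_sumset (A B : {set G}) : 0%R \in B -> A \subset sumset A B.
Proof. by move=> B0; apply/subsetP => x xA; rewrite -[x]addr0 mem_sumset. Qed.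

(** If [g] counts the representations of a point as a sum of a given kind,
    [hits A g y] counts those of [y] as such a sum minus an element of [A]. *)
Definition hits (A : {set G}) (g : G -> nat) (y : G) := \sum_(b in A) g (y + b)%R.

Definition indic (A : {set G}) (x : G) : nat := x \in A.

(** Write [s = x - x'] with [x], [x'] in [A].  From a solution of
    [y = z - b] one gets [y + s = (z + (x - b)) - x'], where [x - b] is a
    difference of [A]; distinct solutions stay distinct. *)
Lemma hits_step (A : {set G}) g y s :
  rep A s * hits A g y <= hits A (conv (indic (diffset A)) g) (y + s)%R.
Proof.
rewrite /rep big_distrl /=.
apply: (@leq_trans (\sum_(x in A | (x - s)%R \in A) hits A g y)).
  rewrite big_mkcondr /=; apply: leq_sum => x _.
  by case: (_ \in A); rewrite ?mul1n.
rewrite [X in _ <= X]/hits.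
rewrite [X in _ <= X]big_mkcond [X in _ <= X](reindex_inj (addIr (- s)%R)).
rewrite [X in X <= _]big_mkcond /=.
apply: leq_sum => x _; case: (boolP (x \in A)) => //= xA.
case: (boolP ((x - s)%R \in A)) => // xsA.
rewrite (addrACA y) subrr addr0 /conv.
rewrite [X in _ <= X](reindex_inj (can_inj (subKr x))) /hits big_mkcond /=.
apply: leq_sum => b _; case: ifP => // bA.
have -> : indic (diffset A) (x - b)%R = 1.
  rewrite /indic; apply/eqP; rewrite eqb1; apply/imsetP; exists (x, b) => //.
  by rewrite inE xA.
by rewrite mul1n opprB addrA addrAC addrK addrC.
Qed.

Lemma sum_hits (A : {set G}) g : \sum_y hits A g y = #|A| * \sum_y g y.
Proof.
rewrite /hits exchange_big /= -sum_nat_const; apply: eq_bigr => b _.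
by rewrite [RHS](reindex_inj (addIr b)).
Qed.

Lemma sum_indic (A : {set G}) : \sum_y indic A y = #|A|.
Proof.
rewrite -sum1_card [RHS]big_mkcond; apply: eq_bigr => x _.
by rewrite /indic; case: (_ \in _).
Qed.

Variables (A : {set G}) (N k4 k2 : nat).
Hypotheses (N0 : 0 < N) (AN : #|A| <= N) (NA : N <= k4 * #|A|).
Hypotheses (k20 : 0 < k2) (DN : #|diffset A| <= k2 * N).

Let K3 := 2 * k2 * k4 ^ 2.
Definition popdiff := [set d | N <= K3 * rep A d].
Local Notation S := popdiff.

Lemma k4_gt0 : 0 < k4.
Proof. by case: k4 NA => //; rewrite mul0n leqNgt N0. Qed.

Lemma card_A_gt0 : 0 < #|A|.
Proof. by case: #|A| NA => //; rewrite muln0 leqNgt N0. Qed.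

(** There are at most [k2 * N] differences in all, and the threshold [K3] is such
    that those with fewer representations account for at most half of the pairs. *)
Lemma sum_popdiff : #|A| ^ 2 <= 2 * \sum_(d in S) rep A d.
Proof.
have h : K3 * \sum_(d | d \notin S) rep A d <= k2 * k4 ^ 2 * #|A| ^ 2.
  apply: (@leq_trans (#|diffset A| * N)).
    rewrite big_distrr -sum_nat_const /= big_mkcond [X in _ <= X]big_mkcond /=.
    apply: leq_sum => d _; rewrite inE -ltnNge; case: ifP => // lt.
    case: ifP => [_|dD]; first exact: ltnW.
    rewrite leqn0 muln_eq0 orbC /rep big1 // => x xA.
    case: (boolP (_ \in A)) => // xdA; move/negP: dD; case.
    by apply/imsetP; exists (x, (x - d)%R); rewrite ?inE ?xA //= subKr.
  apply: (@leq_trans (k2 * N * N)); first by rewrite leq_mul2r DN orbT.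
  rewrite -!(mulnA k2) leq_mul2l -expnMn mulnn leq_sqr NA orbT //.
have k : 0 < k2 * k4 ^ 2 by rewrite muln_gt0 k20 expn_gt0 k4_gt0.
move: h; have := sum_rep A; rewrite (bigID (mem S)) /= => <-.
move: (\sum_(d in S) _) (\sum_(d | _) _) => a b.
have -> : K3 = k2 * k4 ^ 2 * 2 by rewrite /K3; ring.
rewrite -(mulnA _ 2) leq_pmul2l //; lia.
Qed.

Lemma card_A_le : #|A| <= 2 * #|S|.
Proof.
have := sum_popdiff => h.
have : #|A| * #|A| <= 2 * #|S| * #|A|; last by rewrite leq_pmul2r ?card_A_gt0.
rewrite mulnn; apply: (leq_trans h); rewrite -mulnA leq_mul2l /= -sum_nat_const.
by apply: leq_sum => d _; apply: rep_le.
Qed.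

Lemma popdiff0 : 0%R \in S.
Proof.
rewrite inE (leq_trans NA) //.
have -> : rep A 0%R = #|A|.
  by rewrite -sum1_card; apply: eq_bigr => x xA; rewrite subr0 xA.
rewrite leq_mul2r /K3; apply/orP; right.
rewrite -{1}[k4]mul1n (expnD _ 1 1) mulnA leq_mul2r; apply/orP; right.
by rewrite !muln_gt0 k20 k4_gt0.
Qed.

Lemma popdiffN d : d \in S -> (- d)%R \in S.
Proof. by rewrite !inE rep_sym. Qed.

Definition popdiff2 := sumset S S.
Definition popdiff3 := sumset popdiff2 S.
Definition popdiff4 := sumset popdiff3 S.

Let c := K3 ^ 4 * k2 ^ 3.

(** Every sum [s1 + s2 + s3 + s4] of popular differences [si = xi - yi] can be
    rewritten as [x1 + (x2 - y1) + (x3 - y2) + (x4 - y3) - y4], an element of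
    [A + D + D + D - A] with [D] the difference set.  By [hits_step] it is
    obtained in at least a constant times [N^4] ways, and there are at most a
    constant times [N^5] expressions altogether. *)
Lemma card_popdiff4 : #|popdiff4| <= c * N.
Proof.
pose D := indic (diffset A); pose g1 := conv D (indic A).
pose g2 := conv D g1; pose g3 := conv D g2.
(* One application of [hits_step] for each of the last three summands. *)
have low y : y \in popdiff4 -> N ^ 4 <= K3 ^ 4 * hits A g3 y.
  case/sumsetP => y3 [s4 [/sumsetP [y2 [s3 [/sumsetP [s1 [s2 [m1 m2 ->]]] m3 ->]]] m4 ->]].
  have h1 : N <= K3 * hits A (indic A) s1.
    move: m1; rewrite inE; congr (_ <= _ * _); rewrite -rep_sym.
    by apply: eq_bigr => x _; rewrite opprK addrC.
  have st y' s M i g : s \in S -> M <= K3 ^ i * hits A g y' ->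
      N * M <= K3 ^ i.+1 * hits A (conv D g) (y' + s)%R.
    rewrite inE => hs hM.
    apply: leq_trans (leq_mul hs hM) _.
    by rewrite mulnACA expnS leq_mul2l hits_step orbT.
  have h2 := st _ _ _ 1 _ m2 h1.
  have h3 := st _ _ _ _ _ m3 h2.
  have h4 := st _ _ _ _ _ m4 h3.
  by rewrite !(expnS N) expn0 muln1.
have : #|popdiff4| * N ^ 4 <= c * N * N ^ 4; last by rewrite leq_pmul2r ?expn_gt0 ?N0.
rewrite -sum_nat_const; apply: (@leq_trans (K3 ^ 4 * \sum_y hits A g3 y)).
  rewrite big_distrr /= big_mkcond; apply: leq_sum => y _.
  by case: ifP => // yS; apply: low.
rewrite sum_hits !sum_conv !sum_indic /c -!(mulnA (K3 ^ 4)) leq_mul2l.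
apply/orP; right.
apply: (@leq_trans (N * (k2 * N * (k2 * N * (k2 * N * N))))).
  by do 4 apply: leq_mul => //.
by apply/eq_leq; ring.
Qed.

Definition separated (X : {set G}) :=
  (X \subset popdiff3) && [forall x in X, forall y in X, forall s in S, forall s' in S,
    (x + s == y + s')%R ==> (x == y)].

Lemma separatedP (X : {set G}) :
  reflect (X \subset popdiff3 /\ forall x y s s', x \in X -> y \in X -> s \in S -> s' \in S ->
    (x + s = y + s')%R -> x = y) (separated X).
Proof.
apply: (iffP andP) => [] [h1 h2]; split=> //.
  move=> x y s s' xX yX sS s'S /eqP e.
  move/forall_inP: h2 => /(_ _ xX) /forall_inP /(_ _ yX) /forall_inP /(_ _ sS).
  by move=> /forall_inP /(_ _ s'S) /implyP /(_ e) /eqP.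
apply/forall_inP => x xX; apply/forall_inP => y yX; apply/forall_inP => s sS.
apply/forall_inP => s' s'S; apply/implyP => /eqP e; apply/eqP; exact: h2 e.
Qed.

(** Ruzsa covering: for a maximal [X] inside the threefold sums such that the
    translates [x + S] are disjoint, [|X| |S|] is at most the number of fourfold
    sums, and maximality puts every threefold sum in [X + S - S = X + S + S]. *)
Lemma cover_popdiff3 : exists X : {set G}, [/\ #|X| <= 2 * c * k4 &
  forall y, y \in popdiff3 -> exists x t, [/\ x \in X, t \in popdiff2 & y = (x + t)%R]].
Proof.
have [X /maxsetP [/separatedP [XS sep] maxX] _] : {X | maxset separated X & set0 \subset X}.
  by apply: maxset_exists; apply/separatedP; split=> [|x y s s']; rewrite ?sub0set ?inE.
exists X; split.
  have : #|X| * #|S| <= #|popdiff4|.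
    rewrite -cardsX -(card_in_imset (f := fun p : G * G => (p.1 + p.2)%R)).
      apply/subset_leq_card/subsetP => z /imsetP [[x s]]; rewrite inE => /andP [/= xX sS] ->.
      by rewrite mem_sumset // (subsetP XS).
    move=> [x s] [y s']; rewrite !in_setX => /andP [/= xX sS] /andP [/= yX s'S] e.
    have xy := sep _ _ _ _ xX yX sS s'S e; rewrite xy in e *.
    by rewrite (addrI _ e).
  move=> h; have Sgt0 : 0 < #|S| by apply/card_gt0P; exists 0%R; apply: popdiff0.
  rewrite -(leq_pmul2r Sgt0); apply: leq_trans h _; apply: leq_trans card_popdiff4 _.
  apply: (@leq_trans (c * (k4 * #|A|))); first by rewrite leq_mul2l NA orbT.
  apply: (@leq_trans (c * (k4 * (2 * #|S|)))); first by rewrite !leq_mul // card_A_le.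
  by apply/eq_leq; ring.
move=> y yS3; have [yX|yX] := boolP (y \in X).
  exists y, 0%R; split=> //; last by rewrite addr0.
  by rewrite -[0%R]addr0 mem_sumset // popdiff0.
have [|h] := boolP [exists x in X, exists s in S, exists s' in S, (x + s == y + s')%R].
  case/exists_inP => x xX /exists_inP [s sS /exists_inP [s' s'S /eqP e]].
  exists x, (s - s')%R; split=> //; first by rewrite mem_sumset // popdiffN.
  by rewrite addrA e addrK.
have no x s s' : x \in X -> s \in S -> s' \in S -> (x + s)%R <> (y + s')%R.
  move=> xX sS s'S e; case/negP: h; apply/exists_inP; exists x => //.
  by apply/exists_inP; exists s => //; apply/exists_inP; exists s' => //; apply/eqP.
(* Otherwise [X] could be enlarged by [y]. *)
suff yXX : y |: X = X by rewrite -yXX setU11 in yX.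
apply: maxX; last exact: subsetUr.
apply/separatedP; split; first by rewrite subUset sub1set yS3.
move=> x z s s'; rewrite !in_setU1 => /orP [/eqP ->|xX] /orP [/eqP ->|zX] sS s'S e //.
- by case: (no z s' s).
- by case: (no x s s').
exact: sep e.
Qed.

End Sumset.

(** * The span of the popular differences *)

Lemma scale_natF5 m (a : F5) (v : 'rV[F5]_m) : a *: v = v *+ (a : nat).
Proof. by rewrite -scaler_nat natr_Zp. Qed.

Section Freiman.
Variables (m : nat) (A : {set 'rV[F5]_m}) (N k4 k2 : nat).
Hypotheses (N0 : (0 < N)%N) (AN : (#|A| <= N)%N) (NA : (N <= k4 * #|A|)%N).
Hypotheses (k20 : (0 < k2)%N) (DN : (#|diffset A| <= k2 * N)%N).

Let c := ((2 * k2 * k4 ^ 2) ^ 4 * k2 ^ 3)%N.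
Let S := popdiff A N k4 k2.

(** By [cover_popdiff3], adding an element of [S] to a point of
    [span X + S + S] stays inside this set; hence it contains the span of [S],
    which is therefore small because [X] has bounded size. *)
Lemma small_span_popdiff : exists w (W : 'M[F5]_(w, m)), [/\ row_free W,
  (5 ^ w <= 5 ^ (2 * c * k4) * (c * N))%N &
  forall v, v \in S -> exists u, v = u *m W].
Proof.
have [X [cX covX]] := cover_popdiff3 N0 AN NA k20 DN.
pose MX : 'M[F5]_(#|X|, m) := \matrix_(i < #|X|) enum_val i.
pose Z : {set 'rV[F5]_m} := [set (p.1 *m MX + p.2)%R | p in setX setT (popdiff2 A N k4 k2)].
have S0 : 0 \in S := popdiff0 N0 NA k20.
have cS2 : (#|popdiff2 A N k4 k2| <= c * N)%N.
  apply: leq_trans (card_popdiff4 k4 N0 AN DN); apply: subset_leq_card.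
  exact: subset_trans (sub_sumset _ S0) (sub_sumset _ S0).
have cZ : (#|Z| <= 5 ^ (2 * c * k4) * (c * N))%N.
  apply: leq_trans (leq_imset_card _ _) _.
  rewrite cardsX cardsT card_rV leq_mul // leq_pexp2l //.
have Z0 : 0 \in Z.
  apply/imsetP; exists (0, 0); last by rewrite /= mul0mx addr0.
  by rewrite in_setX inE -[X in X \in _]addr0 mem_sumset.
have ZS z s : z \in Z -> s \in S -> s + z \in Z.
  case/imsetP => [[u t]]; rewrite in_setX inE /= => tS2 -> sS.
  have [x [t' [xX t'S e]]] := covX _ (mem_sumset tS2 sS).
  apply/imsetP; exists (u + delta_mx 0 (enum_rank_in xX x), t').
    by rewrite in_setX inE.
  rewrite /= mulmxDl -rowE rowK enum_rankK_in // -addrA -e.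
  by rewrite [LHS]addrC -addrA.
have ZSn z s k : z \in Z -> s \in S -> s *+ k + z \in Z.
  move=> zZ sS; elim: k => [|k IH]; first by rewrite mulr0n add0r.
  by rewrite mulrS -addrA; apply: ZS.
pose MS : 'M[F5]_(#|S|, m) := \matrix_(i < #|S|) enum_val i.
have spanZ u : u *m MS \in Z.
  rewrite mulmx_sum_row; elim/big_rec: _ => // i z _ zZ.
  by rewrite rowK scale_natF5 ZSn // enum_valP.
exists (\rank MS), (row_base MS); split.
- exact: row_base_free.
- apply: leq_trans cZ; rewrite -card_rV -cardsT.
  have inj : injective (fun u : 'rV_(\rank MS) => u *m row_base MS).
    exact: (can_inj (mulmxKp (row_base_free MS))).
  rewrite -(card_imset _ inj); apply/subset_leq_card/subsetP => v /imsetP [u _ ->].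
  have /submxP [D ->] : (u *m row_base MS <= MS)%MS.
    by apply: submx_trans (submxMl _ _) _; rewrite eq_row_base.
  exact: spanZ.
- move=> v vS; apply/submxP; rewrite eq_row_base.
  have -> : v = row (enum_rank_in vS v) MS by rewrite rowK enum_rankK_in.
  exact: row_sub.
Qed.

(** By [sum_popdiff] at least half of the pairs of [A] have a popular difference,
    so some [p0] is congruent to many points of [A] modulo the span of the popular
    differences, which is small. *)
Lemma large_coset_piece : exists w (W : 'M[F5]_(w, m)) p0 (B : {set 'rV_m}), [/\ row_free W,
  (5 ^ w <= 5 ^ (2 * c * k4) * (c * N))%N, B \subset A, (N <= 2 * k4 * #|B|)%N &
  forall p, p \in B -> exists u, p - p0 = u *m W].
Proof.
have [w [W [Wf cW spanW]]] := small_span_popdiff.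
have : (#|A| ^ 2 <= 2 * \sum_(v in A) \sum_(a in A) ((a - v)%R \in S))%N.
  by rewrite -(sum_rep_cond A (mem S)); apply: sum_popdiff.
rewrite big_distrr /= => h.
have [v vA hv] : exists2 v, v \in A & (#|A| <= 2 * \sum_(a in A) ((a - v)%R \in S))%N.
  apply/exists_inP; apply: contraT => /exists_inPn no.
  have : (\sum_(v in A) (2 * \sum_(a in A) ((a - v)%R \in S)).+1 <= \sum_(v in A) #|A|)%N.
    by apply: leq_sum => v vA; rewrite ltnNge no.
  rewrite sum_nat_const mulnn.
  under eq_bigr => v _ do rewrite -addn1.
  rewrite big_split /= sum1_card => h2.
  by have := leq_trans h2 h; rewrite -[X in (_ <= X)%N]addn0 leq_add2l leqNgt (card_A_gt0 N0 NA).
exists w, W, v, [set a in A | a - v \in S]; split=> //.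
- by apply/subsetP => x; rewrite inE => /andP [].
- rewrite card_set_sum (leq_trans NA) // mulnAC [(k4 * _)%N]mulnC leq_mul2r.
  by rewrite hv orbT.
- by move=> p; rewrite inE => /andP [_ /spanW].
Qed.

End Freiman.

(** * Functions whose graph has large additive energy *)

Lemma pigeonhole_fiber (T U : finType) (A : {set T}) (B : {set U}) (f : T -> U) (y0 : U) :
  (forall x, x \in A -> f x \in B) ->
  exists y, (#|A| <= #|B| * #|[set x in A | f x == y]|)%N.
Proof.
move=> fAB.
have [y _ maxy] := @arg_maxnP U y0 predT (fun y => #|[set x in A | f x == y]|) isT.
exists y; rewrite -sum_nat_const -sum1_card (partition_big f (mem B)) //=.
apply: leq_sum => z _; apply: leq_trans (maxy z _) => //.
rewrite -sum1_card; apply/eq_leq/eq_bigl => x; by rewrite inE.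
Qed.

Definition graph n (H : {set 'rV[F5]_n}) (xi : 'rV_n -> 'rV_n) : {set 'rV[F5]_(n + n)} :=
  [set row_mx h (xi h) | h in H].

Section Piece.
Variables (n : nat) (H : {set 'rV[F5]_n}) (xi : 'rV[F5]_n -> 'rV[F5]_n).
Variables (w : nat) (W : 'M[F5]_(w, n + n)) (p0 : 'rV[F5]_(n + n)).
Variables (B : {set 'rV[F5]_(n + n)}) (c k : nat).
Hypotheses (cW : (5 ^ w <= c * 5 ^ n)%N).
Hypotheses (BG : B \subset graph H xi) (cB : (5 ^ n <= k * #|B|)%N).
Hypothesis BW : forall p, p \in B -> exists u, p - p0 = u *m W.

(** A subspace of [F^n * F^n] of size comparable to [5 ^ n] whose projection
    to the first factor is large is, up to a small vertical part, the graph of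
    a linear map; the pigeonhole principle on the vertical part gives one affine
    map that agrees with [xi] on a positive proportion of points. *)
Lemma affine_piece : exists (M : 'M[F5]_n) (t : 'rV[F5]_n),
  (5 ^ n <= k ^ 2 * c * #|[set h in H | (xi h == h *m M + t)%R]|)%N.
Proof.
pose L := lsubmx W; pose R := rsubmx W; pose h0 := lsubmx p0; pose x0 := rsubmx p0.
pose HB := [set h in H | row_mx h (xi h) \in B].
have cHB : (#|B| <= #|HB|)%N.
  apply: leq_trans (leq_imset_card (fun h => row_mx h (xi h)) HB).
  apply/subset_leq_card/subsetP => p pB.
  have /imsetP [h hH e] := subsetP BG _ pB.
  by apply/imsetP; exists h => //; rewrite inE hH -e.
have exU h : exists u : 'rV_w, (h \in HB) ==> ((h - h0 == u *m L) && (xi h - x0 == u *m R)).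
  case hB: (h \in HB); last by exists 0.
  move: hB; rewrite inE => /andP [_ /BW [u e]]; exists u => /=.
  move: e; rewrite -[W]hsubmxK -[p0]hsubmxK mul_mx_row opp_row_mx add_row_mx.
  by move/eq_row_mx => [-> ->]; rewrite !eqxx.
pose U h := xchoose (exU h).
have UL h : h \in HB -> h - h0 = U h *m L.
  by move=> hB; have /implyP /(_ hB) /andP [/eqP] := xchooseP (exU h).
have UR h : h \in HB -> xi h - x0 = U h *m R.
  by move=> hB; have /implyP /(_ hB) /andP [_ /eqP] := xchooseP (exU h).
pose Kr := [set u : 'rV_w | u *m L == 0].
(* [Kr] is the vertical part of the subspace; together with the lifts [U h] of
   the points of [HB] it injects into the parameter space. *)
have cK : (#|Kr| * #|HB| <= 5 ^ w)%N.
  rewrite -cardsX -card_rV.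
  rewrite -(card_in_imset (f := fun p : 'rV_w * 'rV_n => p.1 + U p.2)); first exact: max_card.
  move=> [a x] [b y]; rewrite !in_setX /= [a \in Kr]inE [b \in Kr]inE.
  move=> /andP [/eqP a0 xH] /andP [/eqP b0 yH] e.
  have : (a + U x) *m L = (b + U y) *m L by rewrite e.
  rewrite !mulmxDl a0 b0 !add0r -!UL // => /addIr exy.
  by move: e; rewrite exy => /addIr ->.
(* A partial inverse of the first projection; [P *m R] is the linear part of
   the affine map. *)
have [P PL] : exists P, forall h, h \in HB -> (h - h0) *m P *m L = h - h0.
  by exists (pinvmx L) => h hB; rewrite mulmxKpV // UL // submxMl.
have kin h : h \in HB -> U h - (h - h0) *m P \in Kr.
  by move=> hB; rewrite inE mulmxBl PL // UL // subrr.
have [y hy] := pigeonhole_fiber 0 kin.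
exists (P *m R), (x0 - h0 *m (P *m R) + y *m R).
set Q := [set h in H | _].
have cQ : (#|[set h in HB | (U h - (h - h0) *m P == y)%R]| <= #|Q|)%N.
  apply/subset_leq_card/subsetP => h; rewrite inE => /andP [hB /eqP ey].
  have hH : h \in H by move: hB; rewrite inE => /andP [].
  rewrite inE hH /= -ey; apply/eqP.
  rewrite [in RHS]mulmxBl -UR // -mulmxA mulmxBl.
  rewrite [x0 - _ + _]addrC opprB; move: (h *m _) (h0 *m _) (xi h) => a b z.
  rewrite (addrAC (z - x0)) (addrA (z - x0)) subrK.
  by rewrite [z - b + _]addrA subrK addrCA subrr addr0.
have N0 : (0 < 5 ^ n)%N by rewrite expn_gt0.
rewrite -(leq_pmul2r N0).
apply: (@leq_trans ((k * #|HB|) ^ 2)).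
  by rewrite mulnn leq_sqr (leq_trans cB) // leq_mul2l cHB orbT.
rewrite expnMn -!(mulnA (k ^ 2)%N) leq_mul2l; apply/orP; right.
apply: (@leq_trans (#|Kr| * #|HB| * #|Q|)).
  rewrite -mulnn mulnAC leq_mul2r; apply/orP; right.
  by apply: leq_trans hy _; rewrite leq_mul2l cQ orbT.
apply: leq_trans (leq_mul (leq_trans cK cW) (leqnn _)) _.
by apply/eq_leq; ring.
Qed.

End Piece.

(** Balog-Szemeredi-Gowers finds a large piece of the graph with few differences,
    [large_coset_piece] places a positive proportion of it on a coset of a small
    subspace, and [affine_piece] reads that coset as the graph of an affine map. *)
Lemma linearize_energy (K : nat) : (0 < K)%N -> exists2 K' : nat, (0 < K')%N &
  forall n (H : {set 'rV[F5]_n}) xi,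
  ((5 ^ n) ^ 3 <= K * \sum_d rep (graph H xi) d ^ 2)%N ->
  exists (M : 'M[F5]_n) (t : 'rV[F5]_n),
    (5 ^ n <= K' * #|[set h in H | (xi h == h *m M + t)%R]|)%N.
Proof.
move=> K0.
pose k4 := (4 * (2 * K))%N.
pose k2 := (k4 * (16 * (2 * K) ^ 2 * (2 * K) ^ 2) ^ 2)%N.
pose c := ((2 * k2 * k4 ^ 2) ^ 4 * k2 ^ 3)%N.
have k40 : (0 < k4)%N by rewrite !muln_gt0.
have k20 : (0 < k2)%N by rewrite !(muln_gt0, expn_gt0) K0.
exists ((2 * k4) ^ 2 * (5 ^ (2 * c * k4) * c))%N.
  by rewrite !(muln_gt0, expn_gt0) K0.
move=> n H xi hE.
have N0 : (0 < 5 ^ n)%N by rewrite expn_gt0.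
have cG : (#|graph H xi| <= 5 ^ n)%N.
  by apply: leq_trans (leq_imset_card _ _) _; rewrite -card_rV max_card.
have [A AG [NA DA]] := balog_szemeredi_gowers N0 cG hE.
have AN : (#|A| <= 5 ^ n)%N by apply: leq_trans cG; apply: subset_leq_card.
have [w [W [p0 [B [_ cW BA cB BW]]]]] := large_coset_piece N0 AN NA k20 DA.
apply: (@affine_piece n H xi w W p0 B) => //.
  by rewrite -mulnA.
exact: subset_trans BA AG.
Qed.

(** * Derivatives correlating with linear phases *)

(** The function [phi] of the difference variable is controlled by its own U^2
    norm: two applications of Cauchy-Schwarz remove [g] and [g']. *)
Lemma U2_bound (G : finZmodType) (g g' phi : G -> algC) :
  (forall x, `|g x| <= 1) -> (forall x, `|g' x| <= 1) ->
  `|\avg_x \avg_h (g x * (g' (x + h) * phi h))| ^+ 4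
    <= \avg_u `|\avg_h (phi h * (phi (h + u))^*)| ^+ 2.
Proof.
move=> g1 g'1.
pose a u := \avg_x (g' x * (g' (x + u))^*).
pose b u := \avg_h (phi h * (phi (h + u))^*).
have le1 : `|\avg_x \avg_h (g x * (g' (x + h) * phi h))| ^+ 2 <= \avg_u (a u * b u).
  apply: le_trans (cauchy_schwarz_diff _ g1) _; apply: le_of_eq.
  rewrite exchange_mean.
  under eq_mean => d do rewrite exchange_mean.
  rewrite exchange_mean; apply: eq_mean => u.
  rewrite /b -meanZl; apply: eq_mean => h.
  rewrite /a -meanZr -[LHS](mean_shift (- h)); apply: eq_mean => x.
  by rewrite subrK addrA subrK rmorphM /=; ring.
rewrite (exprM _ 2 2); apply: (@le_trans _ _ (`|\avg_u (a u * b u)| ^+ 2)).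
  rewrite ler_sqr ?nnegrE ?exprn_ge0 //; apply: (le_trans le1); apply: real_ler_norm.
  by apply: ger0_real; apply: le_trans le1; rewrite exprn_ge0.
apply: cauchy_schwarz_mean => u; apply: norm_mean_le1 => x; apply: prod_norm_le1 => //.
by rewrite norm_conjC.
Qed.

(** The additive quadruples of the graph of [xi] over [H], parametrised by
    their common first difference. *)
Definition graph_quad n (H : {set 'rV[F5]_n}) (xi : 'rV[F5]_n -> 'rV[F5]_n) u h h' : bool :=
  [&& h \in H, h + u \in H, h' \in H, h' + u \in H &
      xi h - xi (h + u) == xi h' - xi (h' + u)].

Lemma sum_graph_quad n (H : {set 'rV[F5]_n}) xi :
  (\sum_u \sum_h \sum_h' graph_quad H xi u h h' = \sum_d rep (graph H xi) d ^ 2)%N.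
Proof.
pose R (u v : 'rV[F5]_n) : nat :=
  (\sum_h [&& h \in H, (h + u)%R \in H & (xi h - xi (h + u) == v)%R])%N.
have repE u v : rep (graph H xi) (row_mx (- u) v) = R u v.
  rewrite /rep big_imset /=; last by move=> x y _ _ /eq_row_mx [].
  rewrite /R big_mkcond; apply: eq_bigr => h _; case: (h \in H) => //=; congr nat_of_bool.
  rewrite opp_row_mx add_row_mx opprK; apply/imsetP/andP.
    case=> x xH /eq_row_mx [-> e]; split=> //; rewrite -e.
    by rewrite opprB addrC subrK.
  case=> hu /eqP e; exists (h + u) => //; congr row_mx.
  by rewrite -e opprB addrC subrK.
have -> : (\sum_d rep (graph H xi) d ^ 2 = \sum_u \sum_v R u v ^ 2)%N.
  rewrite pair_bigA /=.
  rewrite (reindex (fun p : 'rV[F5]_n * 'rV[F5]_n => row_mx (- p.1) p.2)) /=.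
    by apply: eq_bigr => p _; rewrite repE.
  apply: onW_bij; exists (fun d => (- lsubmx d, rsubmx d)) => [[x y]|d] /=.
    by rewrite row_mxKl row_mxKr opprK.
  by rewrite opprK hsubmxK.
apply: eq_bigr => u _.
transitivity (\sum_v \sum_h \sum_h'
   [&& h \in H, (h + u)%R \in H & (xi h - xi (h + u) == v)%R] *
   [&& h' \in H, (h' + u)%R \in H & (xi h' - xi (h' + u) == v)%R])%N; last first.
  apply: eq_bigr => v _; rewrite -mulnn /R big_distrlr /=.
  by [].
rewrite [RHS]exchange_big; apply: eq_bigr => h _ /=.
rewrite [RHS]exchange_big; apply: eq_bigr => h' _ /=.
rewrite (bigD1 (xi h - xi (h + u))) //=.
rewrite eqxx big1 ?addn0.
  rewrite /graph_quad [_ == xi h - xi _]eq_sym.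
  by do 4 case: (_ \in H); case: (_ == _).
by move=> v; rewrite eq_sym => /negbTE ->; rewrite !andbF.
Qed.

(** The Fourier coefficient at [z] of the multiplicative derivative of [f] in
    direction [h], for real-valued [f]. *)
Definition deriv_fourier n (f : 'rV[F5]_n -> algC) (h z : 'rV_n) : algC :=
  \avg_x (f (x + h) * f x * echar (- dot x z)).

Lemma deriv_fourier_sqrE n (f : 'rV[F5]_n -> algC) (h z : 'rV_n) :
  (forall x, f x \is Num.real) ->
  `|deriv_fourier f h z| ^+ 2 =
  \avg_y \avg_x (f x * f (x + y) * (f (x + h) * f (x + h + y) * echar (dot y z))).
Proof.
move=> fr; rewrite norm_mean_sqrE [RHS]exchange_mean; apply: eq_mean => x.
rewrite -[LHS](mean_shift x); apply: eq_mean => y.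
rewrite !rmorphM /= !(CrealP (fr _)) -echarN opprK dotDl echarD.
rewrite (addrC y x) [x + y + h]addrAC.
have e1 : echar (- dot x z) * echar (dot x z) = 1 by rewrite -echarD addNr.
by rewrite -[RHS]mulr1 -e1; ring.
Qed.

Section Energy.
Variables (n : nat) (f : 'rV[F5]_n -> algC) (xi : 'rV[F5]_n -> 'rV[F5]_n).
Hypotheses (fr : forall x, f x \is Num.real) (f1 : forall x, `|f x| <= 1).
Variable H : {set 'rV[F5]_n}.

(** Opening the square turns the correlation of the derivatives into averages,
    over [y], of expressions to which [U2_bound] applies with
    [phi h = echar (dot y (xi h))] on [H].  Averaging the resulting bound over [y]
    keeps exactly the additive quadruples, by orthogonality. *)
Lemma additive_energy_ge (s : algC) : 0 <= s ->
  s <= \avg_h ((h \in H)%:R * `|deriv_fourier f h (xi h)| ^+ 2) ->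
  s ^+ 4 * (5 ^ n)%:R ^+ 3 <= (\sum_d rep (graph H xi) d ^ 2)%N%:R.
Proof.
move=> s0 hs.
pose phi (y h : 'rV[F5]_n) := (h \in H)%:R * echar (dot y (xi h)).
pose g (y x : 'rV[F5]_n) := f x * f (x + y).
pose X y := \avg_x \avg_h (g y x * (g y (x + h) * phi y h)).
have E1 : \avg_h ((h \in H)%:R * `|deriv_fourier f h (xi h)| ^+ 2) = \avg_y X y.
  transitivity (\avg_h \avg_y \avg_x (g y x * (g y (x + h) * phi y h))); last first.
    by rewrite exchange_mean; apply: eq_mean => y; rewrite exchange_mean.
  apply: eq_mean => h; rewrite deriv_fourier_sqrE // -meanZl; apply: eq_mean => y.
  by rewrite -meanZl; apply: eq_mean => x; rewrite /g /phi; ring.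
have g1 y x : `|g y x| <= 1 by apply: prod_norm_le1.
have Xr : \avg_y X y \is Num.real.
  by rewrite -E1; apply: ger0_real; apply: le_trans hs.
have s4 : s ^+ 4 <= \avg_y \avg_u `|\avg_h (phi y h * (phi y (h + u))^*)| ^+ 2.
  apply: (@le_trans _ _ (\avg_y `|X y| ^+ 4)); last first.
    by apply: ler_mean => y; apply: U2_bound.
  apply: (@le_trans _ _ ((\avg_y `|X y| ^+ 2) ^+ 2)); last first.
    apply: le_trans (sqr_mean_le _) _; first by move=> y; rewrite rpredX ?normr_real.
    by apply: ler_mean => y; rewrite -exprM.
  rewrite (exprM _ 2 2) ler_sqr ?nnegrE ?exprn_ge0 //; last first.
    by apply: mean_ge0 => y; rewrite exprn_ge0.
  apply: le_trans (norm_mean_sqr_le _); rewrite ler_sqr ?nnegrE //.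
  by rewrite -E1; apply: le_trans hs _; rewrite real_ler_norm // E1.
have E2 : \avg_y \avg_u `|\avg_h (phi y h * (phi y (h + u))^*)| ^+ 2 =
    \avg_u \avg_h \avg_h' (graph_quad H xi u h h')%:R.
  rewrite exchange_mean; apply: eq_mean => u.
  under eq_mean => y do rewrite norm_mean_sqrE.
  rewrite exchange_mean; apply: eq_mean => h.
  rewrite exchange_mean; apply: eq_mean => h'.
  rewrite (eq_mean (g := fun y => ([&& h \in H, h + u \in H, h' \in H & h' + u \in H])%:R *
     echar (dot y ((xi h - xi (h + u)) - (xi h' - xi (h' + u)))))).
    rewrite meanZl mean_echar subr_eq0 /graph_quad -natrM mulnb.
    by rewrite -!andbA.
  move=> y; rewrite /phi !rmorphM /= !rmorph_nat !dotBr !echarB !rmorphM /= !conjCK.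
  by rewrite -!mulnb !natrM; ring.
move: s4; rewrite E2 => s4.
rewrite -sum_graph_quad natr_sum.
have -> : \sum_u (\sum_h \sum_h' graph_quad H xi u h h')%N%:R =
   (\avg_u \avg_h \avg_h' (graph_quad H xi u h h')%:R) * (5 ^ n)%:R ^+ 3 :> algC.
  under eq_bigr => u _ do rewrite natr_sum.
  under eq_bigr => u _ do under eq_bigr => h _ do rewrite natr_sum sum_mean.
  under eq_bigr => u _ do rewrite sum_mean meanZl.
  rewrite sum_mean meanZl meanZl; ring.
by rewrite ler_wpM2r // exprn_ge0 ?ler0n.
Qed.

End Energy.

Lemma natr_inv_gt0 (K : nat) : (0 < K)%N -> 0 < K%:R^-1 :> algC.
Proof. by move=> K0; rewrite invr_gt0 ltr0n. Qed.

(** The frequencies at which the derivatives of [f] correlate can be taken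
    affine in the direction [h]: restrict to the directions with a large
    coefficient, and apply [linearize_energy] to the graph of [xi] there. *)
Lemma linear_derivative (K : nat) : (0 < K)%N -> exists2 K' : nat, (0 < K')%N &
  forall n (f : 'rV[F5]_n -> algC) xi,
  (forall x, f x \is Num.real) -> (forall x, `|f x| <= 1) ->
  K%:R^-1 <= \avg_h `|deriv_fourier f h (xi h)| ^+ 2 ->
  exists (M : 'M[F5]_n) (t : 'rV[F5]_n),
    K'%:R^-1 <= \avg_h `|deriv_fourier f h (h *m M + t)| ^+ 2.
Proof.
move=> K0; have K20 : (0 < (2 * K) ^ 4)%N by rewrite expn_gt0 muln_gt0 K0.
have [K1 K10 lin] := linearize_energy K20.
exists (K1 * (2 * K))%N; first by rewrite !muln_gt0 K10.
move=> n f xi fr f1 hK.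
pose r : algC := (2 * K)%:R^-1.
have r0 : 0 < r by apply: natr_inv_gt0; rewrite muln_gt0.
have Kr : K%:R^-1 = r + r.
  rewrite /r natrM invfM -mulrDl.
  by have -> : 2%:R^-1 + 2%:R^-1 = 1 :> algC; [by field | rewrite mul1r].
(* The directions outside [H] contribute at most [r], half of the assumed lower bound. *)
pose H := [set h | r <= `|deriv_fourier f h (xi h)| ^+ 2].
have hH : r <= \avg_h ((h \in H)%:R * `|deriv_fourier f h (xi h)| ^+ 2).
  rewrite -(lerD2r r) -Kr; apply: le_trans hK _.
  rewrite -[X in _ + X](mean_const 'rV[F5]_n) -meanD; apply: ler_mean => h.
  rewrite inE; case: (boolP (r <= _)) => hr; first by rewrite mul1r lerDl ltW.
  rewrite mul0r add0r ltW // real_ltNge ?hr // ?rpredX ?normr_real //.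
  exact: gtr0_real.
have [] := lin n H xi.
  rewrite -(ler_nat algC) natrM; have := additive_energy_ge fr f1 (ltW r0) hH.
  rewrite /r exprVn mulrC ler_pdivrMr; last by rewrite -natrX ltr0n.
  by rewrite mulrC -!natrX.
move=> M [t hM]; exists M, t.
set Q := [set h in H | _] in hM.
apply: (@le_trans _ _ (\avg_h ((h \in Q)%:R * r))).
  rewrite meanZr (mean_indic _ (mem Q)) natrM invfM.
  rewrite -/r ler_wpM2r ?(ltW r0) // card_rV.
  rewrite ler_pdivlMr ?ltr0n ?expn_gt0 // mulrC ler_pdivrMr ?ltr0n //.
  by rewrite mulrC -natrM ler_nat.
apply: ler_mean => h; case: (boolP (h \in Q)); last by rewrite mul0r exprn_ge0.
by rewrite inE mul1r => /andP [hh /eqP <-]; rewrite inE in hh.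
Qed.

(** * Integrating an affine family of derivatives *)

Definition quad n (S : 'M[F5]_n) (l : 'rV[F5]_n) (c : F5) (x : 'rV[F5]_n) : F5 :=
  dot (x *m S) x + dot x l + c.

Lemma quad_affine n m (S : 'M[F5]_n) l c (P : 'M[F5]_(m, n)) (y : 'rV[F5]_n) x :
  S^T = S ->
  quad S l c (x *m P + y) =
  quad (P *m S *m P^T) (l *m P^T + (y *m S *m P^T) *+ 2) (quad S l c y) x.
Proof.
move=> sS; rewrite /quad mulr2n !(mulmxDl, dotDl, dotDr).
have -> : dot (x *m P *m S) y = dot x (y *m S *m P^T).
  by rewrite !dot_mulmx sS.
have -> : dot (y *m S) (x *m P) = dot x (y *m S *m P^T).
  by rewrite dotC dot_mulmx.
have -> : dot (x *m P) l = dot x (l *m P^T) by rewrite dot_mulmx.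
have -> : dot (x *m P *m S) (x *m P) = dot (x *m (P *m S *m P^T)) x.
  by rewrite !mulmxA [in RHS]dot_mulmx trmxK.
ring.
Qed.

Lemma quad_sym n m (S : 'M[F5]_n) (P : 'M[F5]_(m, n)) : S^T = S ->
  (P *m S *m P^T)^T = P *m S *m P^T.
Proof. by move=> sS; rewrite !trmx_mul trmxK sS mulmxA. Qed.

Section Symmetry.
Variables (n : nat) (f : 'rV[F5]_n -> algC) (M : 'M[F5]_n) (t : 'rV[F5]_n).
Hypotheses (fr : forall x, f x \is Num.real) (f1 : forall x, `|f x| <= 1).

(** The bilinear form given by [M] is nearly symmetric.  Opening the square and
    shifting gives an average over [x], [z], [h] in which [f x * f z] can be
    removed by Cauchy-Schwarz.  In the coordinates [w = x + z], [p = x + h],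
    [p' = x + h'], the variable [x] no longer occurs inside [f] and enters the
    phase only through the pairing of [x] with [(p - p') *m (M - M^T)]; averaging
    over [x] leaves the density of the kernel of [M - M^T]. *)
Lemma symmetry_defect :
  (\avg_h `|deriv_fourier f h (h *m M + t)| ^+ 2) ^+ 2
    <= \avg_(r : 'rV[F5]_n) ((r *m (M - M^T) == 0)%:R : algC).
Proof.
pose b (x h : 'rV[F5]_n) := dot x (h *m M).
pose psi (x z h : 'rV[F5]_n) := f (x + h) * f (z - h) * echar (b (z - x - h) h - dot h t).
have E1 : \avg_h `|deriv_fourier f h (h *m M + t)| ^+ 2 =
    \avg_x \avg_z (f x * f z * echar (dot (z - x) t) * \avg_h psi x z h).
  transitivity (\avg_h \avg_x \avg_z (f x * f z * echar (dot (z - x) t) * psi x z h)); last first.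
    rewrite exchange_mean; apply: eq_mean => x; rewrite exchange_mean.
    by apply: eq_mean => z; rewrite meanZl.
  apply: eq_mean => h; rewrite norm_mean_sqrE; apply: eq_mean => x.
  rewrite -[LHS](mean_shift (- h)); apply: eq_mean => z.
  rewrite !rmorphM /= !(CrealP (fr _)) subrK -echarN opprK /psi.
  rewrite [dot (z - h) _]dotDr [dot x _]dotDr opprD.
  have -> : b (z - x - h) h - dot h t =
     dot (z - h) (h *m M) - dot x (h *m M) - dot h t.
    by rewrite /b !dotBl; ring.
  by rewrite !echarD !dotBl !echarB !echarN; ring.
have le1 : (\avg_h `|deriv_fourier f h (h *m M + t)| ^+ 2) ^+ 2
    <= \avg_x \avg_z `|\avg_h psi x z h| ^+ 2.
  have sq_norm (X : algC) : 0 <= X -> X ^+ 2 = `|X| ^+ 2.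
    by move=> X0; rewrite ger0_norm.
  rewrite sq_norm; last by apply: mean_ge0 => h; rewrite exprn_ge0.
  rewrite E1; apply: le_trans (norm_mean_sqr_le _) _; apply: ler_mean => x.
  apply: cauchy_schwarz_mean => z; apply: prod_norm_le1; last exact: norm_echar_le1.
  exact: prod_norm_le1.
apply: (le_trans le1).
pose A (w p : 'rV[F5]_n) := f p * f (w - p) * echar (b w p - b p p - dot p t).
have E2 : \avg_x \avg_z `|\avg_h psi x z h| ^+ 2 =
    \avg_w \avg_p \avg_p' (A w p * (A w p')^* * ((p - p') *m (M - M^T) == 0)%:R).
  transitivity (\avg_x \avg_w \avg_p \avg_p'
     (A w p * (A w p')^* * echar (dot x (- ((p - p') *m (M - M^T)))))).
    apply: eq_mean => x; rewrite -[LHS](mean_shift (- x)); apply: eq_mean => w.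
    rewrite norm_mean_sqrE -[LHS](mean_shift (- x)); apply: eq_mean => p.
    rewrite -[LHS](mean_shift (- x)); apply: eq_mean => p'.
    have sh (q : 'rV[F5]_n) : psi x (w - x) (q - x) =
      A w q * echar (dot x (q *m M^T) - dot x (q *m M) + (dot x (x *m M) - b w x + dot x t)).
      rewrite /psi /A (addrC x) subrK.
      have -> : w - x - (q - x) = w - q.
        by rewrite opprB addrA subrK.
      have -> : w - x - x - (q - x) = w - x - q.
        by rewrite opprB addrA subrK.
      rewrite -[RHS]mulrA -echarD; congr (_ * echar _).
      rewrite /b mulmxBl !dotBl !dotBr.
      have -> : dot x (q *m M^T) = dot q (x *m M) by rewrite -dot_mulmx dotC.
      ring.
    rewrite !sh rmorphM /= -echarN.
    have -> : dot x (- ((p - p') *m (M - M^T))) =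
       (dot x (p *m M^T) - dot x (p *m M)) - (dot x (p' *m M^T) - dot x (p' *m M)).
      by rewrite dotNr mulmxBl !mulmxBr !dotBr; ring.
    rewrite mulrACA -echarD; congr (_ * echar _).
    move: (dot x _) (dot x _) (dot x _) (dot x _) (_ + dot x t) => a1 a2 a3 a4 a5; ring.
  rewrite exchange_mean; apply: eq_mean => w.
  rewrite exchange_mean; apply: eq_mean => p.
  rewrite exchange_mean; apply: eq_mean => p'.
  by rewrite meanZl mean_echar oppr_eq0.
have r0 : 0 <= \avg_x \avg_z `|\avg_h psi x z h| ^+ 2.
  by apply: mean_ge0 => x; apply: mean_ge0 => z; rewrite exprn_ge0.
rewrite -(ger0_norm r0) E2.
apply: le_trans (ler_norm_mean _) _.
rewrite -[X in _ <= X](mean_const 'rV[F5]_n) //; apply: ler_mean => w.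
apply: le_trans (ler_norm_mean _) _.
rewrite -[X in _ <= X](mean_const 'rV[F5]_n) //; apply: ler_mean => p.
apply: le_trans (ler_norm_mean _) _.
have -> : \avg_(r : 'rV[F5]_n) ((r *m (M - M^T) == 0)%:R : algC) =
          \avg_p' (((p - p') *m (M - M^T) == 0)%:R : algC).
  by rewrite [LHS](reindex_mean _ (can_inj (subKr p))).
apply: ler_mean => p'; rewrite normrM normr_nat ler_piMl ?ler0n //.
have A1 w' q : `|A w' q| <= 1.
  by apply: prod_norm_le1; [apply: prod_norm_le1 | apply: norm_echar_le1].
by apply: prod_norm_le1 => //; rewrite norm_conjC.
Qed.

Lemma mean_coset_ge (U : pred 'rV[F5]_n) (F : 'rV[F5]_n -> algC) :
  (forall x, 0 <= F x) ->
  exists h0, (\avg_u (U u)%:R) * \avg_h F h <= \avg_u ((U u)%:R * F (h0 + u)).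
Proof.
move=> F0.
have Fr x : F x \is Num.real by apply: ger0_real.
apply: exists_ge_mean.
- by move=> h0; apply: mean_real => u; rewrite rpredM ?rpred_nat.
- by rewrite rpredM ?mean_real // => u; rewrite rpred_nat.
- rewrite exchange_mean -meanZr; apply: ler_mean => u.
  by rewrite meanZl mean_shift.
Qed.

(** On the kernel [U] of [M - M^T], the phase [dot x (u *m M)] is the derivative of
    the quadratic form [q x = dot x (x *m M) / 2].  Passing to a coset of [U] on
    which the correlation is at least average, the twists of [f] by [q] on
    both sides give two functions with a large convolution, and
    [conv_fourier_max] produces the missing linear phase. *)
Lemma integrate_derivative (s : algC) : 0 < s ->
  s <= \avg_h `|deriv_fourier f h (h *m M + t)| ^+ 2 ->
  exists S l c, S^T = S /\
    s ^+ 3 <= `|\avg_x (f x * echar (- quad S l c x))| ^+ 2.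
Proof.
move=> s0 hs.
pose F h := `|deriv_fourier f h (h *m M + t)| ^+ 2.
pose U : pred 'rV[F5]_n := fun r => r *m (M - M^T) == 0.
have hU : s ^+ 2 <= \avg_(r : 'rV[F5]_n) (U r)%:R.
  by apply: le_trans symmetry_defect; rewrite ler_sqr ?nnegrE ?(ltW s0) // (le_trans (ltW s0)).
have [h0 hh0] := @mean_coset_ge U F (fun x => exprn_ge0 _ (normr_ge0 _)).
have s3 : s ^+ 3 <= \avg_u ((U u)%:R * F (h0 + u)).
  by apply: le_trans hh0; rewrite (exprSr s 2) ler_pM ?exprn_ge0 ?(ltW s0).
pose q (x : 'rV[F5]_n) := 3%:R * dot x (x *m M).
(* In [F_5] the inverse of 2 is 3. *)
have two3 : 3%:R + 3%:R = 1 :> F5 by apply: val_inj.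
have qD x u : U u -> q (x + u) = q x + q u + dot x (u *m M).
  move=> /eqP; rewrite mulmxBr => /eqP; rewrite subr_eq0 => /eqP uM.
  rewrite /q mulmxDl !dotDl !dotDr.
  have -> : dot u (x *m M) = dot x (u *m M) by rewrite uM -dot_mulmx dotC.
  have e : dot x (u *m M) = (3%:R + 3%:R) * dot x (u *m M) by rewrite two3 mul1r.
  rewrite [X in _ = _ + X]e; move: (dot x _) (dot x _) (dot u _) => a1 a2 a3; ring.
pose G1 x := f (x + h0) * echar (- q x).
pose G2 x := f x * echar (q x - dot x (h0 *m M + t)).
have G21 x : `|G2 x| <= 1.
  by apply: prod_norm_le1 => //; apply: norm_echar_le1.
have [z hz] := conv_fourier_max G1 G21.
have s3' : s ^+ 3 <= `|fourier G1 z| ^+ 2.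
  apply: le_trans hz; apply: (le_trans s3); apply: ler_mean => u.
  case: (boolP (U u)) => Uu; last by rewrite mul0r exprn_ge0.
  rewrite mul1r /F; apply: le_of_eq; congr (_ ^+ 2).
  rewrite -[LHS](mulr1) -(norm_echar (- q u)) -normrM; congr `|_|.
  rewrite /deriv_fourier -meanZr; apply: eq_mean => x.
  rewrite /G1 /G2 qD // addrA [x + h0 + u]addrAC.
  have -> : dot x ((h0 + u) *m M + t) = dot x (h0 *m M + t) + dot x (u *m M).
    by rewrite mulmxDl !dotDr; ring.
  have -> : echar (- (q x + q u + dot x (u *m M))) =
     echar (- q x) * echar (- q u) * echar (- dot x (u *m M)).
    by rewrite !opprD !echarD.
  rewrite opprD !echarD.
  have : echar (- q x) * echar (q x) = 1 by rewrite -echarD addNr.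
  by move=> e; rewrite -[LHS]mulr1 -e; ring.
(* The symmetric matrix of [q]: as 8 = 3 modulo 5, its form is [3 * dot x (x *m M)]. *)
pose S := 4%:R *: (M + M^T).
have sS : S^T = S by rewrite /S linearZ linearD /= trmxK addrC.
have qE x : q x = quad S 0 0 x.
  rewrite /q /quad dot0r !addr0 /S -scalemxAr dotZl mulmxDr dotDl.
  have -> : dot (x *m M^T) x = dot x (x *m M) by rewrite dot_mulmx trmxK.
  rewrite [dot (x *m M) x]dotC -mulr2n mulrnAr -mulrnAl; congr (_ * _).
  exact: val_inj.
pose y := - h0.
have E x : q (x - h0) + dot (x - h0) z =
  quad S (z + (y *m S) *+ 2) (quad S z 0 y) x.
  rewrite qE.
  have := quad_affine z 0 1%:M y x sS.
  rewrite mulmx1 mul1mx trmx1 !mulmx1 => <-.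
  by rewrite /quad dot0r !addr0.
exists S, (z + (y *m S) *+ 2), (quad S z 0 y); split=> //.
apply: le_trans s3' _; apply: le_of_eq.
congr (`|_| ^+ 2); rewrite /fourier -(mean_shift (- h0)); apply: eq_mean => x.
by rewrite /G1 subrK -mulrA -echarD -opprD E.
Qed.

End Symmetry.

(** The inverse theorem for the U^3 norm on [F_5^n], with unspecified dependence
    of [K'] on [K]. *)
Lemma inverse_theorem (K : nat) : (0 < K)%N -> exists2 K' : nat, (0 < K')%N &
  forall n (f : 'rV[F5]_n -> algC) xi,
  (forall x, f x \is Num.real) -> (forall x, `|f x| <= 1) ->
  K%:R^-1 <= \avg_h `|deriv_fourier f h (xi h)| ^+ 2 ->
  exists S l c, S^T = S /\
    K'%:R^-1 <= `|\avg_x (f x * echar (- quad S l c x))| ^+ 2.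
Proof.
move=> K0; have [K1 K10 lin] := linear_derivative K0.
exists (K1 ^ 3)%N; first by rewrite expn_gt0 K10.
move=> n f xi fr f1 hK; have [M [t hM]] := lin n f xi fr f1 hK.
by have := integrate_derivative fr f1 (natr_inv_gt0 K10) hM; rewrite exprVn -natrX.
Qed.

(** * Counting progressions and correlation with quadratics *)

Definition ap4 n (f0 f1 f2 f3 : 'rV[F5]_n -> algC) : algC :=
  \avg_x \avg_d (f0 x * f1 (x + d) * f2 (x + d *+ 2) * f3 (x + d *+ 3)).

Definition unit_valued (T : Type) (f : T -> algC) := forall x, 0 <= f x <= 1.

Lemma unit_valued_real T (f : T -> algC) : unit_valued f -> forall x, f x \is Num.real.
Proof. by move=> fu x; have /andP [h _] := fu x; apply: ger0_real. Qed.

Lemma unit_valued_norm T (f : T -> algC) : unit_valued f -> forall x, `|f x| <= 1.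
Proof. by move=> fu x; have /andP [h1 h2] := fu x; rewrite ger0_norm. Qed.

Section APInverse.
Variable n : nat.
Implicit Types f g b : 'rV[F5]_n -> algC.

(** The four coefficients 0, 1, 2, 3 are distinct modulo 5, so [von_neumann4]
    controls the count by the function in any one of the four positions. *)
Lemma ap4_le_deriv_fourier f0 f1 f2 f3 b :
  (forall x, `|f0 x| <= 1) -> (forall x, `|f1 x| <= 1) ->
  (forall x, `|f2 x| <= 1) -> (forall x, `|f3 x| <= 1) ->
  (forall x, b x \is Num.real) -> (forall x, `|b x| <= 1) ->
  [\/ f0 = b, f1 = b, f2 = b | f3 = b] ->
  exists xi, `|ap4 f0 f1 f2 f3| ^+ 8 <= \avg_h `|deriv_fourier b h (xi h)| ^+ 2.
Proof.
move=> h0 h1 h2 h3 br b1 cases.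
have E : ap4 f0 f1 f2 f3 = \avg_x \avg_d (f0 (x + 0 *: d) *
   f1 (x + 1 *: d) * f2 (x + 2%:R *: d) * f3 (x + 3%:R *: d)).
  apply: eq_mean => x; apply: eq_mean => d.
  by rewrite scale0r addr0 scale1r !scaler_nat.
rewrite E; case: cases => e; subst b.
- have [xi hxi] := @von_neumann4 n 1 2%:R 3%:R 0 f1 f2 f3 f0 isT isT isT h1 h2 h3 h0 br.
  exists xi; apply: le_trans hxi; apply: le_of_eq.
  congr (`|_| ^+ 8); apply: eq_mean => x; apply: eq_mean => d; ring.
- have [xi hxi] := @von_neumann4 n 0 2%:R 3%:R 1 f0 f2 f3 f1 isT isT isT h0 h2 h3 h1 br.
  exists xi; apply: le_trans hxi; apply: le_of_eq.
  congr (`|_| ^+ 8); apply: eq_mean => x; apply: eq_mean => d; ring.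
- have [xi hxi] := @von_neumann4 n 0 1 3%:R 2%:R f0 f1 f3 f2 isT isT isT h0 h1 h3 h2 br.
  exists xi; apply: le_trans hxi; apply: le_of_eq.
  congr (`|_| ^+ 8); apply: eq_mean => x; apply: eq_mean => d; ring.
- exact: (@von_neumann4 n 0 1 2%:R 3%:R f0 f1 f2 f3 isT isT isT h0 h1 h2 h3 br).
Qed.

Lemma ap4_telescope f g (b := fun x => f x - g x) :
  ap4 f f f f - ap4 g g g g =
  ap4 b f f f + ap4 g b f f + ap4 g g b f + ap4 g g g b.
Proof.
rewrite /ap4 -!meanD -meanB; apply: eq_mean => x.
rewrite -!meanD -meanB; apply: eq_mean => d.
by rewrite /b; ring.
Qed.

End APInverse.

Lemma sum4_large (K : nat) (a b c d : algC) : (0 < K)%N ->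
  K%:R^-1 <= `|a + b + c + d| ->
  [\/ (4 * K)%:R^-1 <= `|a|, (4 * K)%:R^-1 <= `|b|, (4 * K)%:R^-1 <= `|c|
    | (4 * K)%:R^-1 <= `|d|].
Proof.
move=> K0 h; set s := (4 * K)%:R^-1.
have s0 : 0 < s by apply: natr_inv_gt0; rewrite muln_gt0.
have Ks : K%:R^-1 = s + s + s + s.
  rewrite /s natrM invfM -!mulrDl.
  by have -> : 4%:R^-1 + 4%:R^-1 + 4%:R^-1 + 4%:R^-1 = 1 :> algC; [by field | rewrite mul1r].
have lt z : ~~ (s <= `|z|) -> `|z| < s.
  by move=> hz; rewrite real_ltNge ?normr_real ?gtr0_real.
case: (boolP (s <= `|a|)) => [|/lt ha]; first by constructor 1.
case: (boolP (s <= `|b|)) => [|/lt hb]; first by constructor 2.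
case: (boolP (s <= `|c|)) => [|/lt hc]; first by constructor 3.
case: (boolP (s <= `|d|)) => [|/lt hd]; first by constructor 4.
have: `|a + b + c + d| < K%:R^-1.
  rewrite Ks; apply: le_lt_trans (ler_normD _ _) _; apply: ltrD => //.
  apply: le_lt_trans (ler_normD _ _) _; apply: ltrD => //.
  by apply: le_lt_trans (ler_normD _ _) _; apply: ltrD.
by move=> lt'; have := le_lt_trans h lt'; rewrite ltxx.
Qed.

(** If two functions have different counts of progressions, their difference
    occurs in one of the four terms of [ap4_telescope] with a large count, and
    so correlates with a quadratic phase. *)
Lemma ap4_inverse (K : nat) : (0 < K)%N -> exists2 K' : nat, (0 < K')%N &
  forall n (f g : 'rV[F5]_n -> algC), unit_valued f -> unit_valued g ->
  K%:R^-1 <= `|ap4 f f f f - ap4 g g g g| ->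
  exists S l c, S^T = S /\
    K'%:R^-1 <= `|\avg_x ((f x - g x) * echar (- quad S l c x))| ^+ 2.
Proof.
move=> K0; have K80 : (0 < (4 * K) ^ 8)%N by rewrite expn_gt0 muln_gt0 K0.
have [K' K'0 inv] := inverse_theorem K80; exists K' => // n f g fu gu.
rewrite ap4_telescope; set b := fun x => f x - g x => hK.
have f1 := unit_valued_norm fu; have g1 := unit_valued_norm gu.
have fr := unit_valued_real fu; have gr := unit_valued_real gu.
have br x : b x \is Num.real by rewrite rpredB.
have b1 x : `|b x| <= 1. by apply: norm_sub_unit_interval.
have main f0 f1' f2 f3 : (forall x, `|f0 x| <= 1) -> (forall x, `|f1' x| <= 1) ->
    (forall x, `|f2 x| <= 1) -> (forall x, `|f3 x| <= 1) ->
    [\/ f0 = b, f1' = b, f2 = b | f3 = b] -> (4 * K)%:R^-1 <= `|ap4 f0 f1' f2 f3| ->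
    exists S l c, S^T = S /\ K'%:R^-1 <= `|\avg_x (b x * echar (- quad S l c x))| ^+ 2.
  move=> h0 h1 h2 h3 hc hk; have [xi hxi] := ap4_le_deriv_fourier h0 h1 h2 h3 br b1 hc.
  apply: (inv _ _ xi) => //; apply: le_trans hxi.
  by rewrite natrX -exprVn lerXn2r ?nnegrE // ltW // natr_inv_gt0 // muln_gt0.
have [] := sum4_large K0 hK; apply: main => //.
- by constructor 1. - by constructor 2. - by constructor 3. - by constructor 4.
Qed.

(** * Equidistribution of high-rank quadratic maps *)

Lemma fourier_inversion n (G : 'rV[F5]_n -> algC) v :
  G v = \sum_z fourier G z * echar (dot v z).
Proof.
transitivity (\sum_z \avg_u (G u * echar (dot (v - u) z))); last first.
  apply: eq_bigr => z _; rewrite -meanZr; apply: eq_mean => u.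
  by rewrite dotBl echarD -mulrA [echar (- _) * _]mulrC.
rewrite -mean_sum.
rewrite (eq_mean (g := fun u => (5 ^ n)%:R * (G u * (u == v)%:R))).
  rewrite meanZl mean_delta mulrC divfK // -card_rV card_neq0 //.
by move=> u; rewrite -mulr_sumr sum_echar subr_eq0 eq_sym; ring.
Qed.

(** Expand [G] in characters: the zero frequency contributes its mean, each of the
    others at most [eta]. *)
Lemma equidistribution n m (phi : 'rV[F5]_n -> 'rV[F5]_m) (G : 'rV[F5]_m -> algC) eta :
  (forall z, z != 0 -> `|\avg_x echar (dot (phi x) z)| <= eta) ->
  0 <= eta -> (forall v, `|G v| <= 1) ->
  `|\avg_x G (phi x) - \avg_v G v| <= (5 ^ m)%:R * eta.
Proof.
move=> heta eta0 G1.
have -> : \avg_x G (phi x) = \sum_z fourier G z * \avg_x echar (dot (phi x) z).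
  under eq_mean => x do rewrite fourier_inversion.
  by rewrite mean_sum; apply: eq_bigr => z _; rewrite meanZl.
rewrite (bigD1 0) //=.
have -> : \avg_x echar (dot (phi x) 0) = 1.
  by rewrite (eq_mean (g := fun=> 1)) ?mean_const // => x; rewrite dot0r.
have -> : fourier G 0 = \avg_v G v.
  by apply: eq_mean => v; rewrite dot0r oppr0 echar0 mulr1.
rewrite mulr1 addrAC subrr add0r.
apply: le_trans (ler_norm_sum _ _ _) _.
apply: (@le_trans _ _ (\sum_(z : 'rV[F5]_m) eta)); last first.
  by rewrite sumr_const card_rV mulr_natl.
rewrite big_mkcond; apply: ler_sum => z _; case: ifP => // z0.
by rewrite normrM -[eta]mul1r ler_pM // ?norm_fourier_le1 // heta.
Qed.

Lemma card_ker_le n m (S : 'M[F5]_(n, m)) :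
  (#|[pred h : 'rV[F5]_n | (h *m S == 0)%R]| <= 5 ^ (n - \rank S))%N.
Proof.
rewrite -mxrank_ker -card_rV.
apply: (@leq_trans #|[set (u *m row_base (kermx S))%R | u : 'rV_(\rank (kermx S))]|); last first.
  exact: leq_imset_card.
apply/subset_leq_card/subsetP => h; rewrite inE => /eqP hS.
have /submxP [D ->] : (h <= row_base (kermx S))%MS by rewrite eq_row_base; apply/sub_kermxP.
exact: imset_f.
Qed.

Lemma two_neq0 : (2%:R : F5) != 0. Proof. by []. Qed.

(** After squaring, the average over [y] of the phase [2 * dot y (x *m S)] kills
    every [x] outside the kernel of [S]. *)
Lemma gauss_sum_le n (S : 'M[F5]_n) l c r : S^T = S -> (2 * r <= \rank S)%N ->
  `|\avg_x echar (quad S l c x)| <= (5 ^ r)%:R^-1.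
Proof.
move=> sS rS; rewrite -ler_sqr ?nnegrE ?invr_ge0 ?ler0n //.
rewrite -[X in X <= _]ger0_norm ?exprn_ge0 // norm_mean_sqrE exchange_mean.
have E y x : echar (quad S l c (x + y)) * (echar (quad S l c y))^* =
    echar (dot (x *m S) x + dot x l) * echar (dot y (2%:R *: (x *m S))).
  rewrite -echarB -echarD; congr echar.
  rewrite /quad mulmxDl !dotDl !dotDr dotZr.
  have -> : dot (x *m S) y = dot y (x *m S) by rewrite dotC.
  have -> : dot (y *m S) x = dot y (x *m S) by rewrite dot_mulmx sS.
  move: (dot _ _) (dot _ _) (dot _ _) (dot _ _) (dot _ _) => a1 a2 a3 a4 a5; ring.
have -> : \avg_y \avg_x (echar (quad S l c x) * (echar (quad S l c y))^*) =
   \avg_x (echar (dot (x *m S) x + dot x l) * (x *m S == 0)%:R).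
  transitivity (\avg_y \avg_x (echar (dot (x *m S) x + dot x l) * echar (dot y (2%:R *: (x *m S))))).
    apply: eq_mean => y; rewrite -[LHS](mean_shift y); apply: eq_mean => x.
    exact: E.
  rewrite exchange_mean; apply: eq_mean => x.
  by rewrite meanZl mean_echar scaler_eq0 (negbTE two_neq0).
apply: le_trans (ler_norm_mean _) _.
apply: (@le_trans _ _ (\avg_x ([pred h : 'rV[F5]_n | h *m S == 0] x)%:R)).
  by apply: ler_mean => x; rewrite normrM norm_echar mul1r normr_nat.
rewrite mean_indic ler_pdivrMr ?ltr0n ?card_gt0 // card_rV.
rewrite exprVn mulrC ler_pdivlMr; last by rewrite -natrX ltr0n !expn_gt0.
rewrite -!natrX -natrM ler_nat.
apply: leq_trans (leq_mul (card_ker_le S) (leqnn _)) _.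
rewrite -expnM mulnC -expnD leq_pexp2l //; have := rank_leq_row S; lia.
Qed.

Lemma mean_row_mx n m (H : 'rV[F5]_(n + m) -> algC) :
  \avg_z H z = \avg_x \avg_y H (row_mx x y).
Proof.
rewrite /mean -mulr_suml -mulrA -invfM -natrM !card_rV -expnD [(m + n)%N]addnC.
congr (_ / _); rewrite pair_bigA /=.
rewrite (reindex (fun p : 'rV[F5]_n * 'rV[F5]_m => row_mx p.1 p.2)) //=.
apply: onW_bij; exists (fun d => (lsubmx d, rsubmx d)) => [[x y]|d] /=.
  by rewrite row_mxKl row_mxKr.
by rewrite hsubmxK.
Qed.

Lemma dot_row_mx n m (x z : 'rV[F5]_n) (y w : 'rV[F5]_m) :
  dot (row_mx x y) (row_mx z w) = dot x z + dot y w.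
Proof. by rewrite /dot tr_row_mx mul_row_col mxE. Qed.

Section Counting.
Variables (n k : nat) (S : 'I_k -> 'M[F5]_n) (l : 'I_k -> 'rV[F5]_n) (c : 'I_k -> F5).
Hypothesis sS : forall i, (S i)^T = S i.

Definition quads (x : 'rV[F5]_n) : 'rV[F5]_k := \row_i quad (S i) (l i) (c i) x.

Definition form_comb (a : 'rV[F5]_k) : 'M[F5]_n := \sum_i a 0 i *: S i.

Lemma form_combD a b : form_comb (a + b) = form_comb a + form_comb b.
Proof. by rewrite -big_split; apply: eq_bigr => i _; rewrite mxE scalerDl. Qed.

Lemma form_combZ t a : form_comb (t *: a) = t *: form_comb a.
Proof. by rewrite scaler_sumr; apply: eq_bigr => i _; rewrite mxE scalerA. Qed.

Lemma form_comb_sym a : (form_comb a)^T = form_comb a.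
Proof.
by rewrite /form_comb raddf_sum; apply: eq_bigr => i _; rewrite /= linearZ /= sS.
Qed.

Lemma dot_quads a : exists l' c', forall x, dot (quads x) a = quad (form_comb a) l' c' x.
Proof.
exists (\sum_i a 0 i *: l i), (\sum_i a 0 i * c i) => x.
rewrite /dot mxE /quad.
have -> : dot (x *m form_comb a) x = \sum_i a 0 i * dot (x *m S i) x.
  rewrite /form_comb mulmx_sumr /dot mulmx_suml summxE; apply: eq_bigr => i _.
  by rewrite -scalemxAr -scalemxAl mxE.
have -> : dot x (\sum_i a 0 i *: l i) = \sum_i a 0 i * dot x (l i).
  rewrite dotC /dot mulmx_suml summxE; apply: eq_bigr => i _.
  by rewrite -scalemxAl mxE -/(dot _ _) dotC.
rewrite -!big_split; apply: eq_bigr => i _; rewrite !mxE /quad /=; ring.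
Qed.

(** The homogeneous part is recorded exactly; the lower-order terms
    do not affect the bounds for exponential sums. *)
Definition quadratic m (T : 'M[F5]_m) (q : 'rV[F5]_m -> F5) :=
  exists l c, forall x, q x = quad T l c x.

Lemma quadraticD m (T T' : 'M[F5]_m) q q' : quadratic T q -> quadratic T' q' ->
  quadratic (T + T') (fun x => q x + q' x).
Proof.
move=> [l1 [c1 e]] [l2 [c2 e']]; exists (l1 + l2), (c1 + c2) => x.
by rewrite e e' /quad mulmxDr dotDl dotDr; ring.
Qed.

Lemma quadratic_pullback m (a : 'rV[F5]_k) (P : 'M[F5]_(m, n)) :
  quadratic (P *m form_comb a *m P^T) (fun z => dot (quads (z *m P)) a).
Proof.
have [l' [c' e]] := dot_quads a.
exists (l' *m P^T + ((0 : 'rV_n) *m form_comb a *m P^T) *+ 2), (quad (form_comb a) l' c' 0) => z.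
by rewrite -quad_affine ?form_comb_sym // addr0 e.
Qed.

(** Third differences of a quadratic map vanish.  This is the only constraint
    on the values of high-rank quadratics along a progression. *)
Lemma quads_ap4 x d :
  quads (x + d *+ 3) = quads x - quads (x + d) *+ 3 + quads (x + d *+ 2) *+ 3.
Proof.
apply/rowP => i; rewrite !mxE /quad -!scaler_nat !mulmxDl -!scalemxAl !dotDl !dotDr.
rewrite !dotZl !dotZr; move: (dot _ _) (dot _ _) (dot _ _) (dot _ _) (dot _ _) (dot _ _).
move=> a1 a2 a3 a4 a5 a6; ring.
Qed.

Variable r : nat.
Hypothesis high_rank : forall a, a != 0 -> (2 * r <= \rank (form_comb a))%N.

(** Acting on [row_mx x d], this sends the pair to the point [x + j *: d]; it makes
    the values along a progression quadratic in one vector of length [n + n]. *)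
Definition ap_step (j : F5) : 'M[F5]_(n + n, n) := col_mx 1%:M j%:M.

Lemma row_mx_ap_step j (x d : 'rV[F5]_n) : row_mx x d *m ap_step j = x + j *: d.
Proof. by rewrite mul_row_col mulmx1 mul_mx_scalar. Qed.

Definition ap3 (z : 'rV[F5]_(n + n)) : 'rV[F5]_(k + k + k) :=
  row_mx (row_mx (quads (z *m ap_step 0)) (quads (z *m ap_step 1))) (quads (z *m ap_step 2%:R)).

(** The phase is a quadratic form [T] in the pair [(x, d)], built from the three
    blocks [a0 + a1 + a2], [a1 + 2 a2] and [a1 + 4 a2] of combinations of the [S i].
    They cannot all vanish unless [z = 0], and the rank of [T] is at least that
    of any of its blocks. *)
Lemma ap3_sum_le z : z != 0 -> `|\avg_x echar (dot (ap3 x) z)| <= (5 ^ r)%:R^-1.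
Proof.
move=> z0.
pose a0 := lsubmx (lsubmx z); pose a1 := rsubmx (lsubmx z); pose a2 := rsubmx z.
have zE : z = row_mx (row_mx a0 a1) a2 by rewrite !hsubmxK.
pose form j a := ap_step j *m form_comb a *m (ap_step j)^T.
pose T := form 0 a0 + form 1 a1 + form 2%:R a2.
have [l' [c' e]] : quadratic T (fun x => dot (ap3 x) z).
  have q := quadraticD (quadraticD (quadratic_pullback a0 (ap_step 0))
     (quadratic_pullback a1 (ap_step 1))) (quadratic_pullback a2 (ap_step 2%:R)).
  have [l' [c' e]] := q; exists l', c' => x.
  by rewrite -e {1}zE /ap3 !dot_row_mx.
rewrite (eq_mean (g := fun x => echar (quad T l' c' x))); last by move=> x; rewrite e.
have symform j a : (form j a)^T = form j a by apply: quad_sym; apply: form_comb_sym.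
apply: gauss_sum_le; first by rewrite /T !linearD /= !symform.
have sub (X Y : 'M[F5]_(n, n + n)) a : a != 0 -> X *m T *m Y^T = form_comb a ->
    (2 * r <= \rank T)%N.
  move=> a0' E; apply: leq_trans (high_rank a0') _; rewrite -E.
  by apply: leq_trans (mxrankM_maxl _ _) _; apply: mxrankM_maxr.
(* [X] and [Y] extract the blocks of [T] in the coordinates [(x, d)]. *)
pose X : 'M[F5]_(n, n + n) := row_mx 1%:M 0; pose Y : 'M[F5]_(n, n + n) := row_mx 0 1%:M.
have XP j : X *m ap_step j = 1%:M by rewrite mul_row_col mulmx1 mul0mx addr0.
have YP j : Y *m ap_step j = j%:M by rewrite mul_row_col mul0mx mul1mx add0r.
have PX j : (ap_step j)^T *m X^T = 1%:M by rewrite -trmx_mul XP trmx1.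
have PY j : (ap_step j)^T *m Y^T = j%:M by rewrite -trmx_mul YP tr_scalar_mx.
have XX j a : X *m form j a *m X^T = form_comb a.
  by rewrite /form !mulmxA XP mul1mx -mulmxA PX mulmx1.
have XY j a : X *m form j a *m Y^T = form_comb (j *: a).
  by rewrite /form !mulmxA XP mul1mx -mulmxA PY mul_mx_scalar form_combZ.
have YY j a : Y *m form j a *m Y^T = form_comb (j *: (j *: a)).
  by rewrite /form !mulmxA YP -mulmxA PY mul_mx_scalar mul_scalar_mx !form_combZ.
have [m0|m0] := eqVneq (a0 + a1 + a2) 0; last first.
  by apply: (sub X X _ m0); rewrite /T !mulmxDr !mulmxDl !XX -!form_combD.
have [m1|m1] := eqVneq (0 *: a0 + 1 *: a1 + 2%:R *: a2) 0; last first.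
  by apply: (sub X Y _ m1); rewrite /T !mulmxDr !mulmxDl !XY -!form_combD.
have [m2|m2] := eqVneq (0 *: (0 *: a0) + 1 *: (1 *: a1) + 2%:R *: (2%:R *: a2)) 0; last first.
  by apply: (sub Y Y _ m2); rewrite /T !mulmxDr !mulmxDl !YY -!form_combD.
case/negP: z0; rewrite zE.
move: m1 m2; rewrite !scale0r !scale1r !add0r scalerA => m1 m2.
have a20 : a2 = 0.
  have : (2%:R * 2%:R - 2%:R : F5) *: a2 = 0.
    have e1 : 2%:R *: a2 = - a1 by apply/eqP; rewrite -addr_eq0 addrC m1.
    have e2 : (2%:R * 2%:R) *: a2 = - a1 by apply/eqP; rewrite -addr_eq0 addrC m2.
    by rewrite scalerBl e1 e2 subrr.
  by move/eqP; rewrite scaler_eq0 => /orP [//|/eqP].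
have a10 : a1 = 0 by move: m1; rewrite a20 scaler0 addr0.
have a00 : a0 = 0 by move: m0; rewrite a20 a10 !addr0.
by rewrite a00 a10 a20 !row_mx0.
Qed.

(** By [ap3_sum_le] every nontrivial character of the triple of values has a small
    mean; the factor [5 ^ (3 * k)] is the number of characters. *)
Lemma ap3_equidistribution (G : 'rV[F5]_k -> 'rV[F5]_k -> 'rV[F5]_k -> algC) :
  (forall u v w, `|G u v w| <= 1) ->
  `|\avg_x \avg_d G (quads x) (quads (x + d)) (quads (x + d *+ 2))
    - \avg_u \avg_v \avg_w G u v w| <= (5 ^ (3 * k))%:R * (5 ^ r)%:R^-1.
Proof.
move=> G1.
pose G' (v : 'rV[F5]_(k + k + k)) := G (lsubmx (lsubmx v)) (rsubmx (lsubmx v)) (rsubmx v).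
have -> : (3 * k = k + k + k)%N by lia.
have := @equidistribution _ _ ap3 G' _ ap3_sum_le.
rewrite invr_ge0 ler0n => /(_ isT) h.
have {h} := h (fun v => G1 _ _ _).
rewrite !mean_row_mx.
have -> : \avg_x \avg_y G' (ap3 (row_mx x y)) =
   \avg_x \avg_d G (quads x) (quads (x + d)) (quads (x + d *+ 2)).
  apply: eq_mean => x; apply: eq_mean => d; rewrite /G' /ap3 !row_mxKl !row_mxKr.
  by rewrite !row_mx_ap_step scale0r addr0 scale1r scaler_nat.
by under [X in _ - X]eq_mean => u do under eq_mean => v do under eq_mean => w do
  rewrite /G' !row_mxKl !row_mxKr.
Qed.

End Counting.

(** * Positivity of the count for functions of quadratics *)

Lemma mean_unit_valued (G : finZmodType) (f : G -> algC) :
  unit_valued f -> 0 <= \avg_x f x <= 1.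
Proof.
move=> fu; apply/andP; split.
  by apply: mean_ge0 => x; case/andP: (fu x).
by apply: mean_le1 => x; case/andP: (fu x).
Qed.

(** In the limiting model the four values satisfy [u + 3 w = u' + 3 v] with [u'] the
    fourth one.  Conditioning on this common value makes the count a mean
    square of the function [A], whose mean is the square of the mean of [F].
    This positivity is where four terms are special. *)
Lemma model_count_ge k (F : 'rV[F5]_k -> algC) : unit_valued F ->
  (\avg_v F v) ^+ 4 <=
  \avg_u \avg_v \avg_w (F u * F v * F w * F (u - v *+ 3 + w *+ 3)).
Proof.
move=> Fu; pose A w := \avg_u (F (w - u *+ 3) * F u).
have -> : \avg_u \avg_v \avg_w (F u * F v * F w * F (u - v *+ 3 + w *+ 3)) =
    \avg_w (A w) ^+ 2.
  transitivity (\avg_w \avg_v \avg_u (F u * F v * F w * F (u - v *+ 3 + w *+ 3))).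
    rewrite exchange_mean [RHS]exchange_mean; apply: eq_mean => v.
    by rewrite exchange_mean.
  (* The common value [u + 3 w] becomes the new variable [u]. *)
  transitivity (\avg_w \avg_v \avg_u (F (u - w *+ 3) * F v * F w * F (u - v *+ 3))).
    apply: eq_mean => w; apply: eq_mean => v.
    rewrite -[LHS](mean_shift (- (w *+ 3))); apply: eq_mean => u.
    by rewrite (addrAC (u - _)) subrK.
  under eq_mean => w do rewrite exchange_mean.
  rewrite exchange_mean; apply: eq_mean => u.
  rewrite expr2 /A -meanZr; apply: eq_mean => w; rewrite -meanZl; apply: eq_mean => v.
  ring.
have EA : \avg_w A w = (\avg_v F v) ^+ 2.
  rewrite /A exchange_mean expr2 -meanZl; apply: eq_mean => u.
  by rewrite meanZr mean_shift.
rewrite (exprM _ 2 2) -EA; apply: sqr_mean_le => w.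
by apply: mean_real => u; rewrite rpredM // unit_valued_real.
Qed.

Lemma exp4_le_of_close (a b d : algC) : 0 <= a <= 1 -> 0 <= b <= 1 -> `|a - b| <= d ->
  a ^+ 4 <= b ^+ 4 + 4%:R * d.
Proof.
move=> /andP [a0 a1] /andP [b0 b1] ab.
have ar := ger0_real a0; have br := ger0_real b0.
have d0 : 0 <= d by apply: le_trans ab.
have E : a ^+ 4 - b ^+ 4 = (a - b) * (a ^+ 3 + a ^+ 2 * b + a * b ^+ 2 + b ^+ 3) by ring.
rewrite -lerBlDl E; apply: le_trans (real_ler_norm _) _.
  by rewrite rpredM ?rpredB ?rpredD ?rpredM ?rpredX.
rewrite normrM mulrC ler_pM //.
have a2 : a ^+ 2 <= 1 by rewrite exprn_ile1.
have b2 : b ^+ 2 <= 1 by rewrite exprn_ile1.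
rewrite ger0_norm; last by rewrite !addr_ge0 ?mulr_ge0 ?exprn_ge0.
have -> : 4%:R = 1 + 1 + 1 + 1 :> algC by ring.
by rewrite !lerD // ?exprn_ile1 // mulr_ile1 ?exprn_ge0.
Qed.

Section Lower.
Variables (n k r : nat) (S : 'I_k -> 'M[F5]_n) (l : 'I_k -> 'rV[F5]_n) (c : 'I_k -> F5).
Hypothesis sS : forall i, (S i)^T = S i.
Hypothesis high_rank : forall a, a != 0 -> (2 * r <= \rank (form_comb S a))%N.
Variable F : 'rV[F5]_k -> algC.
Hypothesis Fu : unit_valued F.

Let f x := F (quads S l c x).
Let d : algC := (5 ^ (3 * k))%:R * (5 ^ r)%:R^-1.

(** Replace the true distributions of the values by uniform ones, at cost [d] for
    the count and [4 * d] for the fourth power of the mean, and use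
    [model_count_ge]. *)
Lemma ap4_ge : (\avg_x f x) ^+ 4 - 5%:R * d <= ap4 f f f f.
Proof.
have Fr := unit_valued_real Fu; have F1 := unit_valued_norm Fu.
have h1 : `|\avg_x f x - \avg_v F v| <= d.
  have := ap3_equidistribution l c sS high_rank (G := fun u _ _ => F u) (fun u _ _ => F1 u).
  under [X in X - _]eq_mean => x do rewrite mean_const.
  by under [X in _ - X]eq_mean => x do rewrite mean_const mean_const.
pose G u v w := F u * F v * F w * F (u - v *+ 3 + w *+ 3).
have G1 u v w : `|G u v w| <= 1 by rewrite /G; do 3 apply: prod_norm_le1 => //.
have h2 := ap3_equidistribution l c sS high_rank G1.
have E : ap4 f f f f =
    \avg_x \avg_d G (quads S l c x) (quads S l c (x + d)) (quads S l c (x + d *+ 2)).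
  by apply: eq_mean => x; apply: eq_mean => y; rewrite /f quads_ap4.
move: h2; rewrite -E -/d => h2.
have h3 := model_count_ge Fu.
have fu : unit_valued f by move=> x; apply: Fu.
have h4 := exp4_le_of_close (mean_unit_valued fu) (mean_unit_valued Fu) h1.
have Gr : \avg_u \avg_v \avg_w G u v w \is Num.real.
  by do 3 apply: mean_real => ?; rewrite !rpredM.
have fr x : f x \is Num.real by apply: Fr.
have apr : ap4 f f f f \is Num.real.
  by do 2 apply: mean_real => ?; rewrite !rpredM.
move: h2; rewrite real_ler_distl ?rpredB // => /andP [h2 _].
apply: le_trans h2; rewrite lerBrDr; apply: le_trans h3; rewrite -lerBrDr in h4 *.
move: h4; rewrite -!lerBlDr; congr (_ <= _); ring.
Qed.

End Lower.

Lemma ap4_ge_mean (K n k : nat) (S : 'I_k -> 'M[F5]_n) l c (F : 'rV[F5]_k -> algC)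
    (f := fun x => F (quads S l c x)) :
  (0 < K)%N -> (forall i, (S i)^T = S i) ->
  (forall a, a != 0 -> (2 * (3 * k + K) <= \rank (form_comb S a))%N) ->
  unit_valued F ->
  (\avg_x f x) ^+ 4 - K%:R^-1 <= ap4 f f f f.
Proof.
move=> K0 sS hr Fu; apply: le_trans (ap4_ge l c sS hr Fu); rewrite lerD2l lerN2.
have n5 m : (5 ^ m)%:R != 0 :> algC by rewrite pnatr_eq0 expn_eq0.
rewrite expnD natrM invfM mulVKf //.
rewrite ler_pdivrMr ?ltr0n ?expn_gt0 // mulrC ler_pdivlMr ?ltr0n // -natrM ler_nat.
case: K K0 {hr} => // K _; elim: K => // K IH.
rewrite [(5 ^ _)%N]expnS; apply: leq_trans (leq_mul (leqnn 5) IH); lia.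
Qed.

(** * Conditional expectation and energy *)

Section CondExp.
Variables (G : finZmodType) (I : eqType) (phi : G -> I) (f : G -> algC).

Definition fiber_avg (i : I) : algC :=
  (\sum_(x | phi x == i) f x) / #|[pred x | phi x == i]|%:R.

Definition cond_exp (x : G) : algC := fiber_avg (phi x).

Definition measurable (w : G -> algC) := forall x y, phi x = phi y -> w x = w y.

Lemma cond_exp_measurable : measurable cond_exp.
Proof. by move=> x y; rewrite /cond_exp => ->. Qed.

(** The conditional expectation is the orthogonal projection onto functions of
    [phi]. *)
Lemma mean_cond_exp (w : G -> algC) : measurable w ->
  \avg_x (cond_exp x * w x) = \avg_x (f x * w x).
Proof.
move=> mw; rewrite /mean; congr (_ / _).
transitivity (\sum_x \sum_(y | phi y == phi x) f y * (w y / #|[pred z | phi z == phi y]|%:R)).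
  apply: eq_bigr => x _; rewrite /cond_exp /fiber_avg -mulrA mulr_suml.
  by apply: eq_bigr => y /eqP e; rewrite (mw y x e) e [_ * w x]mulrC.
rewrite (exchange_big_dep predT) //=; apply: eq_bigr => y _.
rewrite -mulr_sumr; congr (_ * _).
rewrite sumr_const -[_ *+ _]mulr_natr.
rewrite [X in _ * X%:R](eq_card (B := [pred z | phi z == phi y])); last first.
  by move=> z; rewrite !inE eq_sym.
by rewrite divfK // pnatr_eq0 -lt0n; apply/card_gt0P; exists y; rewrite inE.
Qed.

Lemma fiber_avg_unit : unit_valued f -> unit_valued fiber_avg.
Proof.
move=> fu i; rewrite /fiber_avg; apply/andP; split.
  by rewrite divr_ge0 ?ler0n // sumr_ge0 // => x _; case/andP: (fu x).
set N := #|_|; have [->|N0] := posnP N; first by rewrite invr0 mulr0 ler01.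
rewrite ler_pdivrMr ?ltr0n // mul1r /N -sum1_card natr_sum.
by apply: ler_sum => x _; case/andP: (fu x).
Qed.

Definition energy := \avg_x (cond_exp x) ^+ 2.

End CondExp.

Section Refine.
Variables (G : finZmodType) (I J : eqType) (phi : G -> I) (psi : G -> J) (f : G -> algC).
Hypothesis refines : forall x y, psi x = psi y -> phi x = phi y.
Hypothesis fu : unit_valued f.

(** Pythagoras. *)
Lemma energy_refine :
  energy psi f = energy phi f + \avg_x `|cond_exp psi f x - cond_exp phi f x| ^+ 2.
Proof.
have ur (I' : eqType) (p : G -> I') x : cond_exp p f x \is Num.real.
  exact: (unit_valued_real (fiber_avg_unit p fu)).
under [X in _ + X]eq_mean => x do rewrite real_normK ?rpredB // sqrrB.
rewrite meanD meanB -/(energy psi f) -/(energy phi f).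
have -> : \avg_x (cond_exp psi f x * cond_exp phi f x *+ 2) = energy phi f *+ 2.
  under eq_mean => x do rewrite -mulr_natr.
  rewrite meanZr mulr_natr mean_cond_exp; last first.
    by move=> x y /refines; apply: cond_exp_measurable.
  by rewrite -(mean_cond_exp f (@cond_exp_measurable _ _ phi f)).
by rewrite /energy; ring.
Qed.

Lemma mean_defect w : measurable psi w ->
  \avg_x ((f x - cond_exp phi f x) * w x) = \avg_x ((cond_exp psi f x - cond_exp phi f x) * w x).
Proof.
move=> mw; under eq_mean => x do rewrite mulrBl.
under [RHS]eq_mean => x do rewrite mulrBl.
by rewrite !meanB (mean_cond_exp f mw).
Qed.

Lemma energy_refine_le : energy phi f <= energy psi f.
Proof.
by rewrite energy_refine lerDl; apply: mean_ge0 => x; rewrite exprn_ge0.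
Qed.

End Refine.

Lemma energy_unit (G : finZmodType) (I : eqType) (phi : G -> I) f :
  unit_valued f -> 0 <= energy phi f <= 1.
Proof.
move=> fu; apply: mean_unit_valued => x.
have /andP [h0 h1] : 0 <= cond_exp phi f x <= 1 by apply: fiber_avg_unit.
by rewrite exprn_ge0 // exprn_ile1.
Qed.

(** * Fibres of a linear map *)

Section Fiber.
Variables (n m : nat) (L : 'M[F5]_(n, m)).

Definition ker_basis := row_base (kermx L).
Local Notation B := ker_basis.

Lemma ker_basis_mul0 : B *m L = 0.
Proof. by apply/sub_kermxP; rewrite eq_row_base. Qed.

Lemma ker_basis_free : row_free B. Proof. exact: row_base_free. Qed.

Lemma rank_ker_ge : (n - m <= \rank (kermx L))%N.
Proof. by rewrite mxrank_ker leq_sub2l // rank_leq_col. Qed.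

(** Restriction to a subspace of codimension at most [m] costs at most [2 * m]
    in rank, [m] for each side of the form. *)
Lemma rank_restricted_form (S : 'M[F5]_n) r : (2 * m + r <= \rank S)%N ->
  (r <= \rank (B *m S *m B^T))%N.
Proof.
move=> h; have h1 := mxrank_mul_min B S; have h2 := mxrank_mul_min (B *m S) B^T.
have := rank_ker_ge; have := rank_leq_row S.
have := ker_basis_free; rewrite /row_free => /eqP eB.
move: h1 h2; rewrite mxrank_tr eB; lia.
Qed.

Lemma fiber_shift (y : 'rV[F5]_n) t : (y + t *m B) *m L = y *m L.
Proof. by rewrite mulmxDl -mulmxA ker_basis_mul0 mulmx0 addr0. Qed.

Let rho : algC := (5 ^ \rank (kermx L))%:R / (5 ^ n)%:R.

Lemma mean_fibers (F : 'rV[F5]_n -> algC) :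
  \avg_y \avg_t F (y + t *m B) = \avg_x F x.
Proof.
rewrite exchange_mean -[RHS](mean_const 'rV[F5]_(\rank (kermx L))).
by apply: eq_mean => t; rewrite mean_shift.
Qed.

(** The fibres of [x |-> x *m L] are the cosets of the row space of [ker_basis L]. *)
Lemma fiber_mean y (F : 'rV[F5]_n -> algC) :
  \avg_x ((x *m L == y *m L)%:R * F x) = rho * \avg_t F (y + t *m B).
Proof.
rewrite /mean !card_rV /rho.
have -> : \sum_x (x *m L == y *m L)%:R * F x = \sum_t F (y + t *m B).
  have inj : injective (fun t : 'rV_(\rank (kermx L)) => y + t *m B).
    by move=> t t' /addrI; apply: (can_inj (mulmxKp ker_basis_free)).
  transitivity (\sum_(x in [set y + t *m B | t : 'rV_(\rank (kermx L))]) F x).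
    rewrite [RHS]big_mkcond; apply: eq_bigr => x _.
    case: ifP => [/imsetP [t _ ->]|no]; first by rewrite fiber_shift eqxx mul1r.
    case: eqP => e; last by rewrite mul0r.
    have /submxP [t et] : (x - y <= B)%MS.
      by rewrite eq_row_base; apply/sub_kermxP; rewrite mulmxBl e subrr.
    move/negP: no; case; apply/imsetP; exists t => //.
    by rewrite -et addrC subrK.
  by rewrite big_imset //=; move=> t t' _ _; apply: inj.
rewrite [RHS]mulrC mulrA divfK //.
by rewrite pnatr_eq0 expn_eq0.
Qed.

End Fiber.

(** * Quadratic factors *)

(** A quadratic factor: its atoms are the joint level sets of the linear map [L]
    and of [k] quadratic polynomials. *)
Definition factor_map n m k (L : 'M[F5]_(n, m)) (S : 'I_k -> 'M[F5]_n) l c (x : 'rV[F5]_n) :=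
  (x *m L, quads S l c x).

(** A combination of the quadratic polynomials whose form has rank [r] is a
    function of [r + 1] linear forms: the columns of a column basis of the form,
    together with its linear part.  Adding these to [L] makes one
    polynomial with a nonzero coefficient redundant. *)
Lemma drop_quadratic n m k (L : 'M[F5]_(n, m)) (S : 'I_k.+1 -> 'M[F5]_n) l c a :
  (forall i, (S i)^T = S i) -> a != 0 ->
  exists (L' : 'M[F5]_(n, m + (\rank (form_comb S a) + 1))) (S' : 'I_k -> 'M[F5]_n) l' c',
    (forall i, (S' i)^T = S' i) /\
    forall x y, factor_map L' S' l' c' x = factor_map L' S' l' c' y -> factor_map L S l c x = factor_map L S l c y.
Proof.
move=> sS a0; have [i0 ai0] : exists i, a 0 i != 0.
  apply/existsP; apply: contraNT a0 => /existsPn z; apply/eqP/rowP => i.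
  by rewrite mxE; apply/eqP; rewrite -[_ == _]negbK z.
have [la [ca qa]] := dot_quads S l c a.
exists (row_mx L (row_mx (col_base (form_comb S a)) la^T)).
exists (fun i => S (lift i0 i)), (fun i => l (lift i0 i)), (fun i => c (lift i0 i)).
split=> // x y [] /=; rewrite !mul_mx_row => /eq_row_mx [eL /eq_row_mx [eS el]] eq.
have eM : x *m form_comb S a = y *m form_comb S a.
  by rewrite -(mulmx_base (form_comb S a)) (mulmxA x) (mulmxA y) eS.
have eqa : dot (quads S l c x) a = dot (quads S l c y) a.
  rewrite !qa /quad.
  have -> : dot (x *m form_comb S a) x = dot (y *m form_comb S a) y.
    by rewrite eM dot_mulmx form_comb_sym // eM dotC.
  by have -> : dot x la = dot y la by rewrite /dot el.
have eqi i : quads S l c x 0 (lift i0 i) = quads S l c y 0 (lift i0 i).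
  by have /rowP /(_ i) := eq; rewrite !mxE.
congr pair => //; apply/rowP => i.
have [j ->|->] := unliftP i0 i; first exact: eqi.
have split_dot u : dot u a = u 0 i0 * a 0 i0 + \sum_(j | j != i0) u 0 j * a 0 j.
  by rewrite dotE (bigD1 i0).
have rest : \sum_(j | j != i0) quads S l c x 0 j * a 0 j =
            \sum_(j | j != i0) quads S l c y 0 j * a 0 j.
  apply: eq_bigr => j; case: (unliftP i0 j) => [j' -> _|->]; last by rewrite eqxx.
  by rewrite eqi.
by move: eqa; rewrite !split_dot rest => /addIr/(mulIf ai0).
Qed.

Section FiberCount.
Variables (K n m k : nat) (L : 'M[F5]_(n, m)) (S : 'I_k -> 'M[F5]_n).
Variables (l : 'I_k -> 'rV[F5]_n) (c : 'I_k -> F5) (f : 'rV[F5]_n -> algC).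
Hypotheses (K0 : (0 < K)%N) (sS : forall i, (S i)^T = S i) (fu : unit_valued f).
Local Notation B := (ker_basis L).
Local Notation phi := (factor_map L S l c).
Local Notation f1 := (cond_exp phi f).

(** Functions on a coset of the kernel of [L] are read on [F_5^w], with [w] the dimension
    of the kernel, so that the results above apply to them. *)
Definition on_fiber (g : 'rV[F5]_n -> algC) y t := g (y + t *m B).
Definition ap4_at (g : 'rV[F5]_n -> algC) y :=
  ap4 (on_fiber g y) (on_fiber g y) (on_fiber g y) (on_fiber g y).

Lemma cond_exp_unit : unit_valued f1.
Proof. by move=> x; apply: fiber_avg_unit. Qed.

Lemma mean_cond_exp1 : \avg_x f1 x = \avg_x f x.
Proof.
have := @mean_cond_exp _ _ phi f (fun=> 1) (fun _ _ _ => erefl).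
by under eq_mean => x do rewrite mulr1; under [RHS]eq_mean => x do rewrite mulr1.
Qed.

Lemma ap4_unit p (g : 'rV[F5]_p -> algC) : unit_valued g -> 0 <= ap4 g g g g <= 1.
Proof.
move=> gu; apply: mean_unit_valued => x; apply: mean_unit_valued => d.
by do 3 apply: prod_unit_interval => //.
Qed.

(** On each fibre of [L] the conditional expectation is a function of high-rank
    quadratics, so its count there is almost the fourth power of its mean; by
    convexity, averaging over fibres loses nothing.  Keeping the common
    difference inside the kernel of [L] is what makes the four terms lie in the
    same fibre. *)
Lemma ap4_cond_exp_ge :
  (forall a, a != 0 -> (2 * m + 2 * (3 * k + K) <= \rank (form_comb S a))%N) ->
  (\avg_x f x) ^+ 4 - K%:R^-1 <= \avg_y ap4_at f1 y.
Proof.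
move=> hr.
pose S' i := B *m S i *m B^T.
have sS' i : (S' i)^T = S' i by apply: quad_sym.
have cS' a : form_comb S' a = B *m form_comb S a *m B^T.
  rewrite /form_comb mulmx_sumr mulmx_suml; apply: eq_bigr => i _.
  by rewrite -scalemxAr -scalemxAl.
have hr' a : a != 0 -> (2 * (3 * k + K) <= \rank (form_comb S' a))%N.
  by move=> a0; rewrite cS'; apply: rank_restricted_form; apply: hr.
(* On the fibre through [y] the linear part of the factor is constant. *)
have fib y : (\avg_t on_fiber f1 y t) ^+ 4 - K%:R^-1 <= ap4_at f1 y.
  pose l' i := l i *m B^T + (y *m S i *m B^T) *+ 2.
  pose c' i := quad (S i) (l i) (c i) y.
  pose F v := fiber_avg phi f (y *m L, v).
  have Fu : unit_valued F by move=> v; apply: fiber_avg_unit.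
  have E : on_fiber f1 y =1 (fun t => F (quads S' l' c' t)).
    move=> t; rewrite /on_fiber /cond_exp /F /factor_map fiber_shift; congr (fiber_avg _ _ (_, _)).
    by apply/rowP => i; rewrite !mxE addrC quad_affine.
  have := ap4_ge_mean l' c' K0 sS' hr' Fu.
  rewrite (eq_mean E) /ap4_at /ap4.
  congr (_ <= _); apply: eq_mean => t; apply: eq_mean => d.
  by rewrite !E.
apply: le_trans (ler_mean fib).
rewrite meanB mean_const lerD2r -mean_cond_exp1 -(mean_fibers L).
have r1 x : f1 x \is Num.real := unit_valued_real cond_exp_unit x.
pose a y := \avg_t on_fiber f1 y t.
have ar y : a y \is Num.real by apply: mean_real => t; apply: r1.
rewrite -/(\avg_y a y) (exprM _ 2 2).
apply: (@le_trans _ _ ((\avg_y (a y) ^+ 2) ^+ 2)).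
  have h1 := sqr_mean_le ar.
  rewrite ler_sqr ?nnegrE //; first by rewrite real_exprn_even_ge0 // mean_real.
  by apply: mean_ge0 => y; rewrite real_exprn_even_ge0.
apply: le_trans (sqr_mean_le _) _; first by move=> y; rewrite rpredX.
by apply: ler_mean => y; rewrite -exprM.
Qed.

End FiberCount.

(** That the gain [1 / E] does not depend on [m], [k] or [n] is what bounds the number
    of steps. *)
Definition energy_jump (K E : nat) :=
  forall n m k (L : 'M[F5]_(n, m)) (S : 'I_k -> 'M[F5]_n) l c (f : 'rV[F5]_n -> algC),
  (forall i, (S i)^T = S i) -> unit_valued f ->
  ~~ (\avg_y ap4_at L (cond_exp (factor_map L S l c) f) y - 2%:R / K%:R <= \avg_y ap4_at L f y) ->
  exists (S' : 'I_(k + 5 ^ m) -> 'M[F5]_n) l' c', (forall i, (S' i)^T = S' i) /\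
    energy (factor_map L S l c) f + E%:R^-1 <= energy (factor_map L S' l' c') f.

(** On a positive proportion of fibres the two counts differ, and by
    [ap4_inverse] the defect [f - f1] correlates there with a quadratic phase.
    Choose one polynomial for each value of [L] and adjoin them all: the phases
    become functions of the new factor, so the correlations are inherited by the
    difference of the two conditional expectations, whose mean square is the
    energy gain.  Since the choice is made fibre by fibre, the gain is a
    constant although the number of polynomials grows with [m]. *)
Lemma energy_increment (K : nat) : (0 < K)%N -> exists2 E : nat, (0 < E)%N &
  energy_jump K E.
Proof.
move=> K0; have [K1 K10 inv] := ap4_inverse K0.
exists ((K * K1) ^ 2)%N; first by rewrite expn_gt0 muln_gt0 K0 K10.
move=> n m k L S l c f sS fu.
set phi := factor_map L S l c; set f1 := cond_exp phi f; set B := ker_basis L.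
have f1u : unit_valued f1 := cond_exp_unit L S l c fu.
have apu g y : unit_valued g -> 0 <= ap4_at L g y <= 1.
  by move=> gu; apply: ap4_unit => t; apply: gu.
have apr g y : unit_valued g -> ap4_at L g y \is Num.real.
  by move=> gu; have /andP [h _] := apu g y gu; apply: ger0_real.
have Kpos : 0 < K%:R^-1 :> algC by apply: natr_inv_gt0.
have K1pos : 0 < K1%:R^-1 :> algC by apply: natr_inv_gt0.
pose D y := `|ap4_at L f y - ap4_at L f1 y|.
pose bad y := K%:R^-1 <= D y.
move=> hlt; have hbad : K%:R^-1 <= \avg_y ((bad y)%:R : algC).
  have le2 : 2%:R / K%:R <= \avg_y D y.
    have : \avg_y ap4_at L f y < \avg_y ap4_at L f1 y - 2%:R / K%:R.
      rewrite real_ltNge // ?rpredB ?mean_real // => [y|y|]; rewrite ?apr //.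
      by rewrite rpredM ?rpred_nat // gtr0_real.
    rewrite ltrBrDr -ltrBrDl => /ltW h; apply: (le_trans h).
    rewrite -meanB; apply: ler_mean => y; rewrite /D distrC real_ler_norm //.
    by rewrite rpredB // apr.
  rewrite -(lerD2r (K%:R^-1 : algC)) -[X in _ <= _ + X](mean_const 'rV[F5]_n) -meanD.
  rewrite -mulr2n -[_ *+ 2]mulr_natl; apply: (le_trans le2); apply: ler_mean => y; rewrite /bad.
  case: (boolP (K%:R^-1 <= D y)) => h.
    apply: (@le_trans _ _ 1); last by rewrite lerDl ltW.
    by apply: norm_sub_unit_interval; apply: apu.
  rewrite add0r ltW // real_ltNge ?normr_real // gtr0_real //.
pose rho : algC := (5 ^ \rank (kermx L))%:R / (5 ^ n)%:R.
have rho0 : 0 < rho by rewrite divr_gt0 ?ltr0n ?expn_gt0.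
pose g x := f x - f1 x.
pose cor z (p : 'M[F5]_n * 'rV[F5]_n * F5) :=
  \avg_x ((x *m L == z)%:R * (g x * echar (- quad p.1.1 p.1.2 p.2 x))).
pose isgood z (p : 'M[F5]_n * 'rV[F5]_n * F5) :=
  (p.1.1^T == p.1.1) && (rho * K1%:R^-1 <= `|cor z p|).
(* One polynomial for each value [z] of [L]; the default is harmless, as only
   the bad fibres are used. *)
pose qc z := odflt (0, 0, 0) [pick p | isgood z p].
have qcS z : (qc z).1.1^T = (qc z).1.1.
  rewrite /qc; case: pickP => [p /andP [/eqP h _]|_] //=; exact: trmx0.
have qcgood y : bad y -> rho * K1%:R^-1 <= `|cor (y *m L) (qc (y *m L))|.
  move=> hb; have [S0 [l0 [c0 [S0s h0]]]] := inv _ _ _ (fun t => fu (y + t *m ker_basis L)) (fun t => f1u (y + t *m ker_basis L)) hb.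
  suff [p hp] : exists p, isgood (y *m L) p.
    rewrite /qc; case: pickP => [q /andP [_ h]|no] //.
    by have := no p; rewrite hp.
  pose P := pinvmx B.
  (* The polynomial found on the fibre through [y], extended to the whole space
     along [P]. *)
  exists (P *m S0 *m P^T, l0 *m P^T + ((- (y *m P)) *m S0 *m P^T) *+ 2, quad S0 l0 c0 (- (y *m P))).
  rewrite /isgood /= quad_sym // eqxx /= /cor fiber_mean -/rho normrM gtr0_norm //.
  rewrite ler_pM2l //.
  have -> : \avg_t (g (y + t *m ker_basis L) * echar (- quad (P *m S0 *m P^T)
        (l0 *m P^T + ((- (y *m P)) *m S0 *m P^T) *+ 2) (quad S0 l0 c0 (- (y *m P)))
           (y + t *m ker_basis L))) =
      \avg_t ((on_fiber (L := L) f y t - on_fiber (L := L) f1 y t) * echar (- quad S0 l0 c0 t)).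
    apply: eq_mean => t; congr (_ * echar (- _)).
    rewrite -quad_affine //; congr quad.
    by rewrite mulmxDl -mulmxA mulmxVp ?ker_basis_free // mulmx1 addrAC subrr add0r.
  apply: le_trans h0 _; rewrite expr2 ler_piMl //.
  apply: norm_mean_le1 => t; apply: prod_norm_le1; last exact: norm_echar_le1.
  by apply: norm_sub_unit_interval; [apply: fu | apply: f1u].
pose par (i : 'I_(k + 5 ^ m)) : 'M[F5]_n * 'rV[F5]_n * F5 :=
  match split i with
  | inl i => (S i, l i, c i)
  | inr j => qc (enum_val (cast_ord (esym (card_rV m)) j))
  end.
pose S' i := (par i).1.1; pose l' i := (par i).1.2; pose c' i := (par i).2.
exists S', l', c'; split.
  by move=> i; rewrite /S' /par; case: (split i) => j; [apply: sS | apply: qcS].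
set psi := factor_map L S' l' c'.
have refines x y : psi x = psi y -> phi x = phi y.
  case=> eL eq; congr pair => //; apply/rowP => i.
  have /rowP /(_ (lshift _ i)) := eq.
  by rewrite !mxE /S' /l' /c' /par (unsplitK (inl i)).
have meas_qc z : measurable psi (fun x => echar (- quad (qc z).1.1 (qc z).1.2 (qc z).2 x)).
  move=> x y [_ eq].
  have /rowP /(_ (rshift k (cast_ord (card_rV m) (enum_rank z)))) := eq.
  rewrite !mxE /S' /l' /c' /par (unsplitK (inr _)) /= cast_ordK enum_rankK.
  by move=> ->.
pose h x := cond_exp psi f x - f1 x.
have hbig y : bad y -> K1%:R^-1 <= \avg_t `|on_fiber (L := L) h y t|.
  move=> /qcgood; rewrite /cor.
  set w := fun x => echar (- quad (qc (y *m L)).1.1 (qc (y *m L)).1.2 (qc (y *m L)).2 x).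
  have -> : \avg_x ((x *m L == y *m L)%:R * (g x * w x)) =
            \avg_x ((x *m L == y *m L)%:R * (h x * w x)).
    transitivity (\avg_x (g x * ((x *m L == y *m L)%:R * w x))).
      by apply: eq_mean => x; rewrite mulrCA.
    rewrite (mean_defect phi (psi := psi) f); last first.
      move=> x x' e; have -> : w x = w x' by apply: meas_qc e.
      by case: e => ->.
    by apply: eq_mean => x; rewrite mulrCA.
  rewrite fiber_mean -/rho normrM gtr0_norm // ler_pM2l // => hh.
  apply: (le_trans hh); apply: le_trans (ler_norm_mean _) _.
  by apply: ler_mean => t; rewrite normrM norm_echar mulr1.
rewrite (energy_refine refines fu) lerD2l.
(* By Jensen it suffices to bound the mean of [|h|] from below. *)
apply: (@le_trans _ _ ((\avg_x `|h x|) ^+ 2)); last first.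
  by apply: sqr_mean_le => x; apply: normr_real.
rewrite natrX -exprVn natrM invfM ler_sqr ?nnegrE ?mean_ge0 ?mulr_ge0 ?(ltW Kpos) ?(ltW K1pos) //.
rewrite -(mean_fibers L (fun x => `|h x|)).
apply: (@le_trans _ _ (\avg_y ((bad y)%:R * K1%:R^-1))).
  by rewrite meanZr ler_wpM2r // ltW.
apply: ler_mean => y; case: (boolP (bad y)) => hb; first by rewrite mul1r hbig.
by rewrite mul0r; apply: mean_ge0.
Qed.

(** * Popular differences *)

Definition has_popular_difference (K n : nat) (f : 'rV[F5]_n -> algC) :=
  exists2 d, d != 0 & (\avg_x f x) ^+ 4 - 4%:R / K%:R <=
    \avg_x (f x * f (x + d) * f (x + d *+ 2) * f (x + d *+ 3)).

(** Averaging over fibres is averaging over common differences in the kernel of [L].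
    The difference 0 has weight at most [1 / K], because the kernel is large. *)
Lemma popular_of_fibers K n m (L : 'M[F5]_(n, m)) (f : 'rV[F5]_n -> algC) :
  (0 < K)%N -> (m + K < n)%N -> unit_valued f ->
  (\avg_x f x) ^+ 4 - 3%:R / K%:R <= \avg_y ap4_at L f y ->
  has_popular_difference K f.
Proof.
move=> K0 mn fu h.
set w := \rank (kermx L).
have wn : (n - m <= w)%N := rank_ker_ge L.
pose X d := \avg_x (f x * f (x + d) * f (x + d *+ 2) * f (x + d *+ 3)).
have X01 d : 0 <= X d <= 1.
  apply: mean_unit_valued => x.
  by do 3 apply: prod_unit_interval => //.
have E : \avg_y ap4_at L f y = \avg_(s : 'rV[F5]_w) X (s *m ker_basis L).
  rewrite /ap4_at /ap4 exchange_mean -[RHS](mean_const 'rV[F5]_w).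
  apply: eq_mean => t; rewrite exchange_mean; apply: eq_mean => s.
  rewrite /X -[RHS](mean_shift (t *m ker_basis L)); apply: eq_mean => y.
  by rewrite /on_fiber -!scaler_nat !mulmxDl -!scalemxAl !addrA.
pose c := (\avg_x f x) ^+ 4 - 4%:R / K%:R.
have Kr : K%:R^-1 \is @Num.real algC by rewrite rpredV rpred_nat.
have Kpos : 0 < K%:R^-1 :> algC by apply: natr_inv_gt0.
have cr : c \is Num.real.
  by rewrite rpredB ?rpredX ?mean_real ?rpredM ?rpred_nat // => x; apply: unit_valued_real fu x.
have hs : c <= \avg_(s : 'rV[F5]_w) ((s != 0)%:R * X (s *m ker_basis L)).
  have h2 : \avg_(s : 'rV[F5]_w) X (s *m ker_basis L) <=
      \avg_(s : 'rV[F5]_w) ((s != 0)%:R * X (s *m ker_basis L)) + K%:R^-1.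
    apply: (@le_trans _ _ (\avg_(s : 'rV[F5]_w) ((s != 0)%:R * X (s *m ker_basis L) + 1 * (s == 0)%:R))).
      apply: ler_mean => s; case: eqP => [->|_] /=; last by rewrite !mul1r addr0.
      by rewrite mul0r add0r mul1r; case/andP: (X01 (0 *m ker_basis L)).
    rewrite meanD lerD2l mean_delta mul1r lef_pV2 ?posrE ?ltr0n ?expn_gt0 // ler_nat.
    apply: leq_trans (_ : 5 ^ K <= _)%N; first by apply: ltnW; apply: ltn_expl.
    by rewrite leq_pexp2l //; lia.
  rewrite -(lerD2r (K%:R^-1 : algC)); apply: le_trans h2; rewrite -E; apply: le_trans h.
  rewrite /c -addrA lerD2l -!mulNr -[X in _ + X]mul1r -mulrDl ler_wpM2r ?(ltW Kpos) //.
  by have -> : -4%:R + 1 = - 3%:R :> algC by ring.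
have inj0 s : s != 0 -> s *m ker_basis L != 0.
  move=> s0; apply: contraNneq s0 => e.
  by rewrite -(mulmxKp (ker_basis_free L) s) e mul0mx.
have [s hc] : exists s : 'rV[F5]_w, c <= (s != 0)%:R * X (s *m ker_basis L).
  apply: exists_ge_mean hs => // s; rewrite rpredM ?rpred_nat //.
  by have /andP [h0 _] := X01 (s *m ker_basis L); apply: ger0_real.
have [s0|s0] := eqVneq s 0; last first.
  by exists (s *m ker_basis L); [apply: inj0 | move: hc; rewrite s0 mul1r].
have w0 : (0 < w)%N by lia.
pose s1 : 'rV[F5]_w := const_mx 1.
have s10 : s1 != 0.
  by apply/eqP => /rowP /(_ (Ordinal w0)); rewrite !mxE => /eqP.
exists (s1 *m ker_basis L); first exact: inj0.
move: hc; rewrite s0 eqxx mul0r => hc; apply: (le_trans hc).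
by case/andP: (X01 (s1 *m ker_basis L)).
Qed.

(** The statement proved by induction: [j] bounds the number of energy jumps
    that can still occur. *)
Definition popular_above_energy (K E j m k n : nat) :=
  forall (f : 'rV[F5]_n -> algC) (L : 'M[F5]_(n, m)) (S : 'I_k -> 'M[F5]_n) l c,
  unit_valued f -> (forall i, (S i)^T = S i) ->
  1 - j%:R / E%:R < energy (factor_map L S l c) f -> has_popular_difference K f.

Lemma eventually_all (Q : nat -> nat -> Prop) r :
  (forall i, exists n0, forall n, (n0 < n)%N -> Q i n) ->
  exists n0, forall i n, (i < r)%N -> (n0 < n)%N -> Q i n.
Proof.
move=> h; elim: r => [|r [n0 IH]]; first by exists 0%N.
have [n1 h1] := h r; exists (maxn n0 n1) => i n; rewrite ltnS leq_eqVlt gtn_max.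
by move=> /orP [/eqP ->|ir] /andP [a b]; [apply: h1 | apply: IH].
Qed.

(** If the counts of [f] and of its conditional expectation are close,
    [ap4_cond_exp_ge] provides a popular difference; otherwise the energy jumps and
    one unit of [j] is used up. *)
Lemma high_rank_step (K E : nat) j m k n :
  (0 < K)%N ->
  energy_jump K E ->
  (m + K < n)%N -> popular_above_energy K E j m (k + 5 ^ m) n ->
  forall (f : 'rV[F5]_n -> algC) (L : 'M[F5]_(n, m)) (S : 'I_k -> 'M[F5]_n) l c,
  unit_valued f -> (forall i, (S i)^T = S i) ->
  (forall a, a != 0 -> (2 * m + 2 * (3 * k + K) <= \rank (form_comb S a))%N) ->
  1 - j.+1%:R / E%:R < energy (factor_map L S l c) f -> has_popular_difference K f.
Proof.
move=> K0 incr mn cl f L S l c fu sS hr he.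
have [hle|/(incr _ _ _ _ _ _ _ _ sS fu) [S' [l' [c' [sS' hE]]]]] :=
  boolP (\avg_y ap4_at L (cond_exp (factor_map L S l c) f) y - 2%:R / K%:R <= \avg_y ap4_at L f y).
  apply: (popular_of_fibers K0 mn fu); apply: le_trans hle.
  rewrite lerBrDr; apply: le_trans (ap4_cond_exp_ge L l c K0 sS fu hr).
  rewrite -addrA lerD2l -!mulNr -mulrDl.
  by have -> : - 3%:R + 2%:R = - 1 :> algC; [ring | rewrite mulN1r].
apply: (cl f L S' l' c') => //; apply: lt_le_trans hE.
rewrite -ltrBlDr; apply: le_lt_trans he; rewrite -addrA lerD2l.
by rewrite -opprD lerN2 -[X in _ + X]mul1r -mulrDl natr1.
Qed.

(** Induction on the number [j] of remaining energy jumps, then on the number [k] of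
    polynomials: a factor of low rank loses one polynomial by [drop_quadratic],
    without loss of energy, and a factor of high rank is handled by
    [high_rank_step]. *)
Lemma popular_above_energy_holds (K : nat) : (0 < K)%N -> exists2 E : nat, (0 < E)%N &
  forall j m k, exists n0, forall n, (n0 < n)%N -> popular_above_energy K E j m k n.
Proof.
move=> K0; have [E E0 incr] := energy_increment K0; exists E => //.
elim=> [|j IHj].
  move=> m k; exists 0%N => n _ f L S l c fu _; rewrite mul0r subr0 => h.
  have /andP [_ le1] := energy_unit (factor_map L S l c) fu.
  by have := lt_le_trans h le1; rewrite ltxx.
move=> m k; elim: k m => [|k IHk] m.
  have [n1 h1] := IHj m (0 + 5 ^ m)%N.
  exists (maxn n1 (m + K)) => n; rewrite gtn_max => /andP [n1n mn] f L S l c fu sS he.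
  apply: (high_rank_step K0 incr mn (h1 n n1n) fu sS _ he) => a /eqP [].
  by apply/rowP => -[].
have [n1 h1] := IHj m (k.+1 + 5 ^ m)%N.
(* [2 * m] for the restriction to fibres, and [5 ^ (3 * k.+1 + K)] to beat the
   number of triples of values and the target error. *)
set R := (2 * m + 2 * (3 * k.+1 + K))%N.
have [n2 h2] := @eventually_all (fun r n => popular_above_energy K E j.+1 (m + (r + 1)) k n) R
  (fun r => IHk _).
exists (maxn (maxn n1 n2) (m + K)) => n; rewrite !gtn_max => /andP [/andP [n1n n2n] mn].
move=> f L S l c fu sS he.
case: (boolP [forall a, (a != 0) ==> (R <= \rank (form_comb S a))%N]) => [/forallP hr|].
  apply: (high_rank_step K0 incr mn (h1 n n1n) fu sS _ he) => a.
  by apply/implyP.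
rewrite negb_forall => /existsP [a]; rewrite negb_imply -ltnNge => /andP [a0 low].
have [L' [S' [l' [c' [sS' ref]]]]] := drop_quadratic L l c sS a0.
apply: (h2 _ _ low n2n f L' S' l' c' fu sS').
by apply: lt_le_trans he _; apply: energy_refine_le.
Qed.

Lemma popular_difference (K : nat) : (0 < K)%N ->
  exists n0, forall n, (n0 < n)%N -> forall f : 'rV[F5]_n -> algC, unit_valued f ->
    has_popular_difference K f.
Proof.
move=> K0; have [E E0 cl] := popular_above_energy_holds K0.
have [n0 h] := cl E.+1 0%N 0%N; exists n0 => n nn f fu.
apply: (h n nn f 0 (fun=> 0) (fun=> 0) (fun=> 0) fu) => [i|].
  exact: trmx0.
set phi := factor_map _ _ _ _; apply: (@lt_le_trans _ _ 0); last first.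
  by case/andP: (energy_unit phi fu).
by rewrite subr_lt0 ltr_pdivlMr ?ltr0n // mul1r ltr_nat.
Qed.

Theorem theorem4p1 (R : realType) (alpha eps : R)
    (alpha_gt0 : 0 < alpha) (eps_gt0 : 0 < eps) :
  exists n0 : nat, forall n : nat, (n0 < n)%N ->
    forall A : {set 'rV['F_5]_n}, #|A|%:R = alpha * (5 ^ n)%N%:R ->
      exists d : 'rV['F_5]_n, d != 0 /\
        (alpha ^+ 4 - eps) * (5 ^ n)%N%:R <= #|ap4_starts A d|%:R.
Proof.
(* The error [eps] is traded for a rational [4 / K], so that the inequality to
   transfer from the algebraic numbers to [R] is one between natural numbers. *)
pose K := (Num.truncn (4%:R / eps)).+1.
have K4 : 4%:R / K%:R <= eps.
  rewrite ler_pdivrMr ?ltr0n // mulrC -ler_pdivrMr //.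
  by apply/ltW; apply: truncnS_gt.
have [n0 h] := @popular_difference K isT; exists n0 => n nn A hA.
pose f (x : 'rV[F5]_n) : algC := (x \in A)%:R.
have fu : unit_valued f by move=> x; rewrite /f ler0n lern1 leq_b1.
have [d d0 hd] := h n nn f fu; exists d; split=> //.
set N := (5 ^ n)%N in hA *.
have N0 : (0 < N)%N by rewrite expn_gt0.
have Ef : \avg_x f x = #|A|%:R / N%:R by rewrite mean_indic card_rV.
have Ed : \avg_x (f x * f (x + d) * f (x + d *+ 2) * f (x + d *+ 3)) =
    #|ap4_starts A d|%:R / N%:R.
  rewrite /N -card_rV -(mean_indic algC (mem (ap4_starts A d))); apply: eq_mean => x.
  by rewrite /f -!natrM !mulnb /= inE -!andbA.
have key : (K * #|A| ^ 4 <= K * #|ap4_starts A d| * N ^ 3 + 4 * N ^ 4)%N.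
  move: hd; rewrite Ef Ed -(ler_nat algC) lerBlDr => hd.
  have N4 : 0 < K%:R * N%:R ^+ 4 :> algC by rewrite mulr_gt0 ?exprn_gt0 ?ltr0n.
  move: hd; rewrite -(ler_pM2l N4).
  have Nn : N%:R != 0 :> algC by rewrite pnatr_eq0 -lt0n.
  have Kn : K%:R != 0 :> algC by rewrite pnatr_eq0.
  congr (_ <= _); rewrite !(natrD, natrM, natrX); field; rewrite ?Kn expf_neq0 ?pnatr_eq0 //.
clearbody N.
have Nr : 0 < N%:R :> R by rewrite ltr0n.
have Kr : 0 < K%:R :> R by rewrite ltr0n.
apply: (@le_trans _ _ ((alpha ^+ 4 - 4%:R / K%:R) * N%:R)).
  by rewrite ler_pM2r // lerB.
move: key; rewrite -(ler_nat R) !(natrD, natrM, natrX) hA => key.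
have N3 : 0 < K%:R * N%:R ^+ 3 :> R by rewrite mulr_gt0 ?exprn_gt0.
rewrite -(ler_pM2l N3) mulrBl mulrBr lerBlDr.
move: key; congr (_ <= _); first by ring.
by field; rewrite gt_eqF.
Qed.
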